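(* Let $G\subseteq \mathrm{GL}_d(\mathbb{C})$ be one of the following complex Lie groups: $\mathrm{SL}_n(\mathbb{C})$ with $n\ge 2$ (here $d=n$); $\mathrm{SO}_n(\mathbb{C})$ with $n\ge 5$ (here $d=n$); or $\mathrm{Sp}_{2n}(\mathbb{C})$ with $n\ge 1$ (here $d=2n$). Then there exist three $\mathbb{C}$-complete polynomial vector fields $W_1,W_2,W_3$ on $G$ such that $\mathfrak{X}_{\mathrm{alg}}(G)=\operatorname{Lie}\{W_1,W_2,W_3\}$.
   Context: Groups: $\mathrm{SL}_n(\mathbb{C})=\{x\in\mathrm{GL}_n(\mathbb{C})\mid \det x=1\}$; $\mathrm{SO}_n(\mathbb{C})=\{x\in\mathrm{SL}_n(\mathbb{C})\mid x^\top x=I\}$; $\mathrm{Sp}_{2n}(\mathbb{C})=\{x\in\mathrm{SL}_{2n}(\mathbb{C})\mid x^\top\Omega x=\Omega\}$ with $\Omega=\begin{pmatrix}0&I_n\\-I_n&0\end{pmatrix}$. A vector field $V$ on $G\subseteq\mathrm{GL}_d(\mathbb{C})$ is viewed as a map $V:G\to\mathbb{C}^{d\times d}$ with $V(x)\in T_xG=x\mathfrak{g}$ for all $x\in G$, where $\mathfrak{g}\subseteq\mathbb{C}^{d\times d}$ is the Lie algebra of $G$. It is polynomial if the entries of $V(x)$ are (restrictions to $G$ of) polynomials in the entries $x_{ij}$ of $x$. $\mathfrak{X}_{\mathrm{alg}}(G)$ denotes the complex Lie algebra of all polynomial vector fields on $G$, with the Lie bracket $[V,W]=VW-WV$ of vector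 fields acting as derivations on functions. A holomorphic vector field $V$ is $\mathbb{C}$-complete if its flow $e^{tV}:G\to G$ is well defined for every complex time $t\in\mathbb{C}$. For a set $S$ of holomorphic vector fields, $\operatorname{Lie}(S)$ is the complex Lie algebra generated by $S$. All vector spaces and Lie algebras are over $\mathbb{C}$. *)

(* Defs.v *)
From HB Require Import structures.
From mathcomp Require Import all_boot all_order all_algebra.
From mathcomp Require Import all_classical all_reals all_analysis.
From mathcomp.real_closed Require Export complex.
(* [mpoly] is not imported: its notations clash with those of the analysis
   library. *)
From mathcomp Require mpoly.

Set Implicit Arguments.
Unset Strict Implicit.
Unset Printing Implicit Defensive.

Import Order.TTheory GRing.Theory Num.Theory.
Import numFieldNormedType.Exports.

Local Open Scope classical_set_scope.
Local Open Scope ring_scope.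

Section Groups.
Variable K : numFieldType.

Definition SL (n : nat) : set 'M[K]_n := [set x | \det x = 1].

Definition SO (n : nat) : set 'M[K]_n :=
  [set x | SL x /\ x^T *m x = 1%:M].

Definition Omega (n : nat) : 'M[K]_(n + n) := block_mx 0 1%:M (- 1%:M) 0.

Definition Sp (n : nat) : set 'M[K]_(n + n) :=
  [set x | SL x /\ x^T *m Omega n *m x = Omega n].

Inductive classical_group : forall d : nat, set 'M[K]_d -> Prop :=
| classical_SL n of (2 <= n)%N : classical_group (@SL n)
| classical_SO n of (5 <= n)%N : classical_group (@SO n)
| classical_Sp n of (1 <= n)%N : classical_group (@Sp n).

End Groups.

Section VectorFields.
Variables (K : numFieldType) (d : nat) (G : set 'M[K]_d).

(* The matrix-valued map [gamma] has derivative [A] at [t], entry by entry. The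
   normed field [K] is also the field of scalars, so for [K] the field of
   complex numbers this is the complex derivative. *)
Definition has_derivative (gamma : K -> 'M[K]_d) (t : K) (A : 'M[K]_d) : Prop :=
  forall i j, is_derive t (1 : K) (fun s : K => gamma s i j) (A i j).

(* The tangent space of [G] at the identity: velocities at [0] of germs of
   holomorphic curves in [G] through the identity. *)
Definition lie_algebra : set 'M[K]_d := [set A | exists gamma : K -> 'M[K]_d,
  [/\ \forall t \near (0 : K),
        G (gamma t) /\ exists B, has_derivative gamma t B,
      gamma 0 = 1%:M
    & has_derivative gamma 0 A]].

(* [G], coerced to a type, is the type of the elements of [G]. *)
Definition matrix_field : Type := G -> 'M[K]_d.

Definition is_vector_field (V : matrix_field) : Prop :=
  forall x : G, exists2 A, lie_algebra A & V x = val x *m A.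

(* Polynomials in the matrix entries [x i j], with one variable for each index
   [mxvec_index i j] of the row vector [mxvec x]. *)
Definition entry_poly : Type := mpoly.mpoly (d * d) K.

Definition poly_eval (p : entry_poly) (x : 'M[K]_d) : K :=
  mpoly.meval (fun k => mxvec x 0 k) p.

Definition poly_deriv (p : entry_poly) (i j : 'I_d) : entry_poly :=
  mpoly.mderiv (mxvec_index i j) p.

Definition is_polynomial (V : matrix_field) : Prop :=
  forall i j, exists p : entry_poly, forall x : G, V x i j = poly_eval p (val x).

Definition X_alg : set matrix_field :=
  [set V | is_vector_field V /\ is_polynomial V].

(* [V] acting as a derivation on the function on [G] represented by [p]. When
   [V] is tangent to [G] the result depends only on the restriction of [p]. *)
Definition act (V : matrix_field) (p : entry_poly) (x : G) : K :=
  \sum_i \sum_j V x i j * poly_eval (poly_deriv p i j) (val x).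

(* [U = V W - W V] as derivations on polynomial functions on [G]: here [q] and
   [r] represent the functions [W p] and [V p]. If [V] and [W] are in [X_alg],
   such [q] and [r] always exist, and [U] is unique (let [p] be a variable). *)
Definition is_lie_bracket (V W U : matrix_field) : Prop :=
  forall p q r : entry_poly,
    (forall x : G, poly_eval q (val x) = act W p x) ->
    (forall x : G, poly_eval r (val x) = act V p x) ->
    forall x : G, act U p x = act V q x - act W r x.

Definition lie_subalgebra (L : set matrix_field) : Prop :=
  [/\ L `<=` X_alg,
      L (fun=> 0),
      forall (a : K) V W, L V -> L W -> L (fun x => a *: V x + W x)
    & forall V W U, L V -> L W -> is_lie_bracket V W U -> L U].

Definition lie_generated (S : set matrix_field) : set matrix_field :=
  \bigcap_(L in [set L | lie_subalgebra L /\ S `<=` L]) L.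

(* [phi t] is the time-[t] flow map of [V]; its time parameter is an arbitrary
   scalar, so for [K] the field of complex numbers this is completeness in
   complex time. *)
Definition is_flow (V : matrix_field) (phi : K -> G -> G) : Prop :=
  forall x : G, phi 0 x = x /\
    forall t : K, has_derivative (fun s => val (phi s x)) t (V (phi t x)).

Definition C_complete (V : matrix_field) : Prop := exists phi, is_flow V phi.

End VectorFields.

Arguments X_alg {K d} G.

(* Main.v *)
(** Let [g] be the Lie algebra of [G] and write [f A] for the left-invariant field
of [A] in [g] multiplied by a polynomial function [f]; these fields span
[X_alg G]. Take a diagonalizable [H] in [g] with simple spectrum and consider
- [W1 x = c H x + x H], whose flow is given by exponentials of multiples of [H];
- [W2 x = x N] with [N^3 = 0], whose flow is polynomial in time;
- [W3 = f E] with [E^2 = 0] and [f] a sum of all weight vectors among the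
  linear functions; along the flow [f] grows exponentially, so [W3] is complete
  (but not divergence free, which is essential).

Let [L] be a Lie algebra containing them. Separating the eigenvalues of [ad W1]
puts all components of [N], hence [g] itself, and then [x_ij E], in [L]; since
[E] generates [g] as an ideal, [x_ij A] is in [L] for every [A] in [g].

Call [f] a multiplier if [f A] is in [L] for all [A] in [g]. For multipliers [f]
and [h] a combination of brackets based on the Jacobi identity shows that
[C A f h . A' - C A' f h . A + C f h . [A, A']], with no derivative of [h], lies
in [L]. For [A = H], [A' = E] and [f] a linear function killed by [E] and of weight
[lambda], this is a nonzero multiple of [(C f) h E]. Hence multipliers are
closed under multiplication by the coordinates [x_ij], so every polynomial is a
multiplier and [L] is everything.

The three families are the groups [det x = 1], [x^T B x = B] with [B = 0], [B = 1]
and [B = Omega]; for [SO_n] the torus is diagonal in an isotropic basis. The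
group [SL_2] is treated as [Sp_2]. *)

Require Import Defs.
From mathcomp Require Import all_boot all_order all_algebra.
From mathcomp Require Import all_classical all_reals all_analysis.
From mathcomp.real_closed Require Import complex.
From mathcomp Require mpoly.
From mathcomp Require Import perm ring lra zify.
Import -(notations) mpoly.

Set Implicit Arguments.
Unset Strict Implicit.
Unset Printing Implicit Defensive.

Import Order.TTheory GRing.Theory Num.Theory.
Import numFieldNormedType.Exports.

Local Open Scope classical_set_scope.
Local Open Scope complex_scope.
Local Open Scope ring_scope.

(** * Complex differentiation and the complex exponential *)

(** Invariant fields preserve Haar measure and brackets of fields preserving it do so again. [W1]
    and [W2] are of this kind, while [f E] has divergence [E f]; hence [f] must not be killed by
    [E], and the flow of [W3] involves an exponential although [E^2 = 0].

    Right-invariant fields commute with left-invariant ones, so [W1] acts on the latter as [ad H]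
    alone. On the coordinates of [x] in an eigenbasis of [H] it has the eigenvalues [c l_i + l_j],
    pairwise distinct for generic [c]. A single field thus separates the components of [N] and also
    those of [f].

    The obstacle to products is that a bracket of [f A] and [h C] differentiates both factors. Once
    the derivatives of [h] are cancelled, [h] may be any multiplier and the degree can grow one
    coordinate at a time.

    The tangent space is defined by curves. It is matched with the linear equations of the Lie
    algebra through elements of cube zero: they span, and their exponentials are polynomial.

    The size conditions leave room for the ideal generated by [E]: the Lie algebra of [SO_4] splits
    into two ideals. For [SL_n] the chosen [N] takes [n >= 3]. *)

Lemma is_derive1P (K : numFieldType) (f : K -> K) (a c : K) :
  is_derive a 1 f c <->
  forall e : K, 0 < e -> exists2 r : K, 0 < r &
    forall h, `|h| < r -> `|f (h + a) - f a - h * c| <= e * `|h|.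
Proof.
(* Clearing the denominator turns the limit over nonzero [h] into an estimate that also makes sense,
   trivially, at [h = 0]. *)
have key e h : h != 0 :> K ->
    (`|c - h^-1 * (f (h * 1 + a) - f a)| <= e) =
    (`|f (h + a) - f a - h * c| <= e * `|h|).
  move=> h0; rewrite mulr1.
  have -> : c - h^-1 * (f (h + a) - f a) =
      - ((f (h + a) - f a - h * c) / h) by field.
  by rewrite normrN normrM normfV ler_pdivrMr ?normr_gt0.
split=> [[/cvg_ex [l fl] dfc] e e0|fc].
  have lc : l = c by rewrite -dfc; apply/esym/cvg_lim.
  move: fl; rewrite lc => /cvgrPdist_le /(_ _ e0).
  move=> /nbhs_ballP [r r0 fr]; exists r => // h hr.
  have [->|h0] := eqVneq h 0; first by rewrite add0r subrr mul0r subrr normr0 mulr0.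
  rewrite -key//; apply: fr => //=.
  by rewrite -ball_normE/= sub0r normrN.
have fl : (fun h => h^-1 *: ((f \o shift a) (h *: 1) - f a)) @ 0^' --> c.
  apply/cvgrPdist_le => e e0; have [r r0 fr] := fc _ e0.
  apply/nbhs_ballP; exists r => //= h; rewrite -ball_normE/= sub0r normrN => hr h0.
  by have := fr _ hr; rewrite -key.
by split; [apply/cvg_ex; exists c|exact: cvg_lim].
Qed.

(** The only analytic input to the flows. Keeping it abstract lets everything up to the final
    theorem be done over an arbitrary [numFieldType]. *)
Record is_exponential (K : numFieldType) (ex : K -> K) : Prop := IsExponential {
  exponential0 : ex 0 = 1;
  exponentialD : forall a b, ex (a + b) = ex a * ex b;
  is_derive_exponential : forall t : K, is_derive t (1 : K) ex (ex t)
}.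

Section ComplexExponential.
Variable R : realType.
Let C : numFieldType := R[i].

Definition cexp (z : R[i]) : R[i] :=
  (expR (complex.Re z) * cos (complex.Im z)) +i*
  (expR (complex.Re z) * sin (complex.Im z)).

Lemma normc_le_abs (x y : R) : `|x +i* y| <= (`|x| + `|y|)%:C.
Proof.
have -> : x +i* y = x%:C + 'i%C * y%:C by rewrite [LHS]complexE.
rewrite rmorphD/= (le_trans (ler_normD _ _))// normrM.
have -> : `|'i%C| = 1 :> R[i] by rewrite normc_def/= expr0n expr1n add0r sqrtr1.
by rewrite mul1r !normc_def/= expr0n/= addr0 addr0 !sqrtr_sqr.
Qed.

Lemma normc_ge_abs (z : R[i]) :
  (`|complex.Re z|%:C <= `|z|) /\ (`|complex.Im z|%:C <= `|z|).
Proof.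
by split; rewrite normc_def lecR -sqrtr_sqr ler_wsqrtr// ?lerDl ?lerDr sqr_ge0.
Qed.

(** The real linearizations of [expR], [cos] and [sin] at 0 are combined by explicit estimates on
    real and imaginary parts. Other points follow from the functional equation. *)
Lemma is_derive_cexp0 : is_derive (0 : C) (1 : C) (cexp : C -> C) 1.
Proof.
apply/is_derive1P => e e0.
have [d d0 ed] : exists2 d : R, 0 < d & e = d%:C.
  exists (complex.Re e); first by move: e0; rewrite ltcE => /andP[].
  by rewrite RRe_real// gtr0_real.
have /is_derive1P /(_ (d / 8)) := @is_derive_expR R 0.
have /is_derive1P /(_ (d / 8)) := @is_derive_sin R 0.
have /is_derive1P /(_ (d / 8)) := @is_derive_cos R 0.
rewrite !cos0 sin0 expR0 => + + +.
have d8 : 0 < d / 8 by lra.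
move=> /(_ d8) [r1 r1_gt0 hcos] /(_ d8) [r2 r2_gt0 hsin] /(_ d8) [r3 r3_gt0 hexp].
(* The bound 1 gives [|1 + a| <= 2]; the bound [d / 16] absorbs the mixed term [|a| * |b|] coming
   from [(E - 1) * s]. *)
pose m : R := Num.min (Num.min r1 r2) (Num.min r3 (Num.min 1 (d / 16))).
have m0 : 0 < m by rewrite /m !lt_min r1_gt0 r2_gt0 r3_gt0/=; lra.
exists m%:C; first by rewrite ltcR.
move=> [a b] hab.
have [la lb] := normc_ge_abs (a +i* b); rewrite /= in la lb.
have := le_lt_trans la hab; have := le_lt_trans lb hab.
rewrite !ltcR /m !lt_min => /and3P[/andP[b1 b2] b3 /andP[b4 b5]].
move=> /and3P[/andP[a1 a2] a3 /andP[a4 a5]].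
rewrite ed; apply: (@le_trans _ _ (d * (`|a| + `|b|) / 2)%:C); last first.
  rewrite rmorphM/= rmorphM/= -!mulrA ler_pM2l ?ltcR//.
  rewrite rmorphD/= -[leRHS]mulr1.
  apply: (@le_trans _ _ ((`|a +i* b| + `|a +i* b|) * 2^-1%:C)).
    by apply: ler_wpM2r; [rewrite lecR; lra | exact: lerD].
  have -> : 2^-1%:C = 2^-1 :> R[i] by rewrite fmorphV rmorph_nat.
  by rewrite mulr1 -mulr2n -[X in X / 2]mulr_natr mulfK.
have {hcos} := hcos _ b1; have {hsin} := hsin _ b2; have {hexp} := hexp _ a3.
rewrite !addr0 oppr0 mulr0 !subr0 addr0 !mulr1 => he hs hc.
have -> : cexp (a +i* b) - cexp 0 - a +i* b =
   (expR a * cos b - 1 - a) +i* (expR a * sin b - b).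
  rewrite /cexp/= expR0 cos0 sin0 mulr0 mulr1.
  by apply/eqP; rewrite eq_complex/=; apply/andP; split; apply/eqP; ring.
apply: le_trans (normc_le_abs _ _) _; rewrite lecR.
move: he hs hc; set E := expR a; set c := cos b; set s := sin b => he hs hc.
have -> : E * c - 1 - a = (E - 1 - a) * c + (1 + a) * (c - 1) by ring.
have -> : E * s - b = (E - 1) * s + (s - b) by ring.
have c1 : `|c| <= 1 by rewrite ler_norml cos_geN1 cos_le1.
have a0 := normr_ge0 a; have b0 := normr_ge0 b.
have a1' : `|1 + a| <= 2.
  by rewrite (le_trans (ler_normD _ _))// normr1; lra.
have E1 : `|E - 1| <= d / 8 * `|a| + `|a|.
  have -> : E - 1 = (E - 1 - a) + a by ring.
  by rewrite (le_trans (ler_normD _ _))// lerD2r.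
have s1 : `|s| <= 1 by rewrite ler_norml sin_geN1 sin_le1.
have s2 : `|s| <= d / 8 * `|b| + `|b|.
  have -> : s = (s - b) + b by ring.
  by rewrite (le_trans (ler_normD _ _))// lerD2r.
have t1 : `|(E - 1 - a) * c| <= d / 8 * `|a|.
  by rewrite normrM -[leRHS]mulr1 ler_pM.
have t2 : `|(1 + a) * (c - 1)| <= 2 * (d / 8 * `|b|) by rewrite normrM ler_pM.
have t3 : `|(E - 1) * s| <= d / 8 * `|a| * 1 + `|a| * (d / 8 * `|b| + `|b|).
  apply: (@le_trans _ _ ((d / 8 * `|a| + `|a|) * `|s|)).
    by rewrite normrM ler_wpM2r.
  by rewrite mulrDl lerD// ler_wpM2l// mulr_ge0// ltW.
have t4 : `|a| * (d / 8 * `|b| + `|b|) <= d / 8 * `|a| + d / 16 * `|b|.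
  rewrite mulrDr lerD//; last by rewrite ler_wpM2r// ltW.
  by rewrite mulrCA ler_wpM2l ?(ltW d8)// ler_piMr// ltW.
apply: (@le_trans _ _ (d / 8 * `|a| + 2 * (d / 8 * `|b|) +
   (d / 8 * `|a| + (d / 8 * `|a| + d / 16 * `|b|) + d / 8 * `|b|))).
  apply: lerD; apply: le_trans (ler_normD _ _) _; apply: lerD => //.
  by rewrite (le_trans t3)// mulr1 lerD.
nra.
Qed.

Lemma cexp_is_exponential : is_exponential (cexp : C -> C).
Proof.
have expD a b : cexp (a + b) = cexp a * cexp b.
  case: a b => [a1 a2] [b1 b2]; rewrite /cexp/= expRD cosD sinD.
  by apply/eqP; rewrite eq_complex/=; apply/andP; split; apply/eqP; ring.
have exp0 : cexp 0 = 1 by rewrite /cexp/= expR0 cos0 sin0 mulr0 mulr1.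
split=> // t.
apply/is_derive1P => e e0.
have /is_derive1P /(_ (e / (1 + `|cexp t|))) := is_derive_cexp0.
have n0 : 0 < 1 + `|cexp t| by rewrite ltr_wpDr.
rewrite divr_gt0// => /(_ isT) [r r0 hr]; exists r => // h /hr {hr}.
have -> : cexp (h + t) - cexp t - h * cexp t =
    cexp t * (cexp (h + 0) - cexp 0 - h * 1).
  by rewrite addr0 expD exp0 !mulr1; ring.
move=> hr; rewrite normrM.
apply: (@le_trans _ _ ((1 + `|cexp t|) * (e / (1 + `|cexp t|) * `|h|))).
  by apply: ler_pM => //; rewrite lerDr.
by rewrite mulrA mulrCA divff ?gt_eqF// mulr1.
Qed.

End ComplexExponential.

(** * Differentiation rules for scalar and matrix curves *)

Section Derivatives.
Variable K : numFieldType.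
Implicit Types (t a b c : K) (f g : K -> K).

Lemma is_derive_add t f g a b :
  is_derive t (1 : K) f a -> is_derive t (1 : K) g b ->
  is_derive t (1 : K) (fun s => f s + g s) (a + b).
Proof. by move=> fa gb; exact: is_deriveD. Qed.

Lemma is_derive_mul t f g a b :
  is_derive t (1 : K) f a -> is_derive t (1 : K) g b ->
  is_derive t (1 : K) (fun s => f s * g s) (a * g t + f t * b).
Proof.
by move=> fa gb; apply: is_derive_eq; rewrite addrC; congr (_ + _); exact: mulrC.
Qed.

Lemma is_derive_const t c : is_derive t (1 : K) (fun=> c) 0.
Proof. exact: is_derive_cst. Qed.

Lemma is_derive_scale t c f a :
  is_derive t (1 : K) f a -> is_derive t (1 : K) (fun s => c * f s) (c * a).
Proof.
move=> fa; have := is_derive_mul (is_derive_const t c) fa.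
by rewrite mul0r add0r.
Qed.

Lemma is_derive_bigsum t (I : Type) (r : seq I) (f : I -> K -> K) (a : I -> K) :
  (forall i, is_derive t (1 : K) (f i) (a i)) ->
  is_derive t (1 : K) (fun s => \sum_(i <- r) f i s) (\sum_(i <- r) a i).
Proof.
move=> fa; elim: r => [|i r IH].
  under eq_fun do rewrite big_nil.
  by rewrite big_nil; exact: is_derive_const.
under eq_fun do rewrite big_cons.
by rewrite big_cons; exact: is_derive_add.
Qed.

Lemma is_derive_bigprod t (I : eqType) (r : seq I) (f : I -> K -> K)
    (a : I -> K) : uniq r ->
  (forall i, is_derive t (1 : K) (f i) (a i)) ->
  is_derive t (1 : K) (fun s => \prod_(i <- r) f i s)
    (\sum_(i <- r) a i * \prod_(j <- r | j != i) f j t).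
Proof.
move=> + fa; elim: r => [_|i r IH /= /andP[ir /IH{}IH]].
  under eq_fun do rewrite big_nil.
  by rewrite big_nil; exact: is_derive_const.
under eq_fun do rewrite big_cons.
apply: (is_derive_eq (is_derive_mul (fa i) IH)).
rewrite big_cons big_cons eqxx/=; congr (_ * _ + _).
  rewrite big_seq [RHS]big_seq_cond; apply: eq_bigl => j.
  by case: eqVneq => [->|]; rewrite ?andbT// (negPf ir).
rewrite mulr_sumr; apply: eq_big_seq => j jr.
rewrite big_cons; case: eqVneq => [ij|_]; last by rewrite mulrCA.
by rewrite ij jr in ir.
Qed.

Lemma is_derive_compZ t c f a :
  is_derive (c * t) (1 : K) f a ->
  is_derive t (1 : K) (fun s => f (c * s)) (c * a).
Proof.
have [->|c0] := eqVneq c 0.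
  by move=> _; rewrite mul0r; under eq_fun do rewrite mul0r; exact: is_derive_const.
move=> /is_derive1P fa; apply/is_derive1P => e e0.
have c1 : 0 < `|c| by rewrite normr_gt0.
have [r r0 fr] := fa _ (divr_gt0 e0 c1).
exists (r / `|c|); first by rewrite divr_gt0.
move=> h; rewrite ltr_pdivlMr// mulrC -normrM => /fr.
by rewrite mulrDr mulrCA mulrA normrM mulrA divfK ?gt_eqF// (mulrC h).
Qed.

Lemma is_derive_exponentialZ (ex : K -> K) (c t : K) : is_exponential ex ->
  is_derive t (1 : K) (fun s => ex (c * s)) (c * ex (c * t)).
Proof. by move=> [_ _ dex]; exact: is_derive_compZ. Qed.

Variable d : nat.
Implicit Types A B : 'M[K]_d.

Lemma has_derivative_cst t A : has_derivative (fun=> A) t 0.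
Proof. by move=> i j; rewrite mxE; exact: is_derive_const. Qed.

Lemma has_derivative_add t (u v : K -> 'M[K]_d) A B :
  has_derivative u t A -> has_derivative v t B ->
  has_derivative (fun s => u s + v s) t (A + B).
Proof.
move=> uA vB i j; under eq_fun do rewrite mxE.
by rewrite mxE; exact: is_derive_add.
Qed.

Lemma has_derivative_scale t f a A :
  is_derive t (1 : K) f a -> has_derivative (fun s => f s *: A) t (a *: A).
Proof.
move=> fa i j; under eq_fun do rewrite mxE mulrC.
by rewrite mxE mulrC; exact: is_derive_scale.
Qed.

Lemma has_derivative_mul t (u v : K -> 'M[K]_d) A B :
  has_derivative u t A -> has_derivative v t B ->
  has_derivative (fun s => u s *m v s) t (A *m v t + u t *m B).
Proof.
move=> uA vB i j; under eq_fun do rewrite mxE.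
rewrite !mxE -big_split/=; apply: is_derive_bigsum => k.
exact: is_derive_mul.
Qed.

Lemma has_derivative_mull t (v : K -> 'M[K]_d) A B :
  has_derivative v t B -> has_derivative (fun s => A *m v s) t (A *m B).
Proof.
move=> vB; have := has_derivative_mul (has_derivative_cst t A) vB.
by rewrite mul0mx add0r.
Qed.

Lemma has_derivative_mulr t (u : K -> 'M[K]_d) A B :
  has_derivative u t A -> has_derivative (fun s => u s *m B) t (A *m B).
Proof.
move=> uA; have := has_derivative_mul uA (has_derivative_cst t B).
by rewrite mulmx0 addr0.
Qed.

Lemma has_derivative_compZ t c (u : K -> 'M[K]_d) A :
  has_derivative u (c * t) A ->
  has_derivative (fun s => u (c * s)) t (c *: A).
Proof.
by move=> uA i j; rewrite mxE; exact: (is_derive_compZ (f := fun s => u s i j)).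
Qed.

Lemma has_derivative_unique t (u : K -> 'M[K]_d) A B :
  has_derivative u t A -> has_derivative u t B -> A = B.
Proof.
by move=> uA uB; apply/matrixP => i j; case: (uA i j) (uB i j) => [_ <-] [_ <-].
Qed.

Lemma has_derivative_tr t (u : K -> 'M[K]_d) A :
  has_derivative u t A -> has_derivative (fun s => (u s)^T) t A^T.
Proof.
by move=> uA i j; under eq_fun do rewrite mxE; rewrite mxE.
Qed.

(** In the Leibniz expansion a permutation other than the identity moves at least two indices. Each
    term of its product rule therefore keeps an undifferentiated off-diagonal factor, which vanishes
    at [u t = 1]. *)
Lemma is_derive_det (u : K -> 'M[K]_d) (t : K) A : u t = 1%:M ->
  has_derivative u t A -> is_derive t (1 : K) (fun s => \det (u s)) (\tr A).
Proof.
move=> u1 uA.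
have dprod s := is_derive_bigprod (enum_uniq 'I_d) (fun i => uA i ((s : 'S_d) i)).
have dsum := is_derive_bigsum (enum 'S_d)
  (fun s => is_derive_scale ((-1) ^+ s) (dprod s)).
have -> : (fun s => \det (u s)) = (fun x => \sum_(i <- enum 'S_d)
    (-1) ^+ i * \prod_(j <- enum 'I_d) u x j (i j)).
  by apply/funext => x; rewrite big_enum/=; apply: eq_bigr => s _; rewrite big_enum.
apply: (is_derive_eq dsum); rewrite big_enum/= (bigD1 (perm_one 'I_d))//=.
rewrite odd_perm1 expr0 mul1r.
rewrite [X in _ + X]big1 ?addr0.
  rewrite big_enum/=; apply: eq_bigr => i _; rewrite perm1 big1 ?mulr1// => j _.
  by rewrite perm1 u1 mxE eqxx.
move=> s s1; rewrite big_enum/= big1 ?mulr0// => i _.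
have [j ji sj] : exists2 j, j != i & s j != j.
  have [si|si] := eqVneq (s i) i; last first.
    by exists (s i) => //; apply: contraNneq si => /perm_inj ->.
  have [[j sj]|sE] := pselect (exists j, s j != j).
    by exists j => //; apply: contraNneq sj => ->; rewrite si.
  case/eqP: s1; apply/permP => j; rewrite perm1; apply/eqP.
  by apply/negP => /negP ?; apply: sE; exists j.
have jd : j \in enum 'I_d by rewrite mem_enum.
rewrite (big_rem j)//= ji u1 mxE eq_sym (negPf sj).
by rewrite mul0r mulr0.
Qed.

End Derivatives.

(** * Polynomials in the matrix entries *)

Section EntryPolynomials.
Variables (K : numFieldType) (d : nat).
Local Notation mp := (mpoly (d * d) K).
Implicit Types (p q : mp) (x A : 'M[K]_d).

Definition entry_var (i j : 'I_d) : mp := mpolyX K (mnm1 (mxvec_index i j)).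

Lemma entry_poly_ind (P : mp -> Prop) :
  (forall c, P (mpolyC _ c)) -> (forall i j, P (entry_var i j)) ->
  (forall p q, P p -> P q -> P (p + q)) ->
  (forall p q, P p -> P q -> P (p * q)) -> forall p, P p.
Proof.
move=> PC PX PD PM; apply: mpolyind => [|c m p _ _ Pp].
  by have := PC 0; rewrite mpolyC0.
apply: (PD) => //; rewrite -mul_mpolyC; apply: (PM) => //.
rewrite mpolyXE_id; elim/big_ind: _ => [||k _]; [exact: (PC 1)|exact: PM|].
elim: (m k) => [|n IH]; first exact: (PC 1).
rewrite exprS; apply: (PM) => //.
by case/mxvec_indexP: k {IH} => i j; exact: PX.
Qed.

Lemma poly_evalD p q x : poly_eval (p + q) x = poly_eval p x + poly_eval q x.
Proof. exact: mevalD. Qed.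

Lemma poly_evalB p q x : poly_eval (p - q) x = poly_eval p x - poly_eval q x.
Proof. exact: mevalB. Qed.

Lemma poly_evalM p q x : poly_eval (p * q) x = poly_eval p x * poly_eval q x.
Proof. exact: mevalM. Qed.

Lemma poly_evalC c x : poly_eval (mpolyC _ c : mp) x = c.
Proof. exact: mevalC. Qed.

Lemma poly_eval0 x : poly_eval (0 : mp) x = 0.
Proof. exact: meval0. Qed.

Lemma poly_eval1 x : poly_eval (1 : mp) x = 1.
Proof. exact: meval1. Qed.

Lemma poly_eval_var i j x : poly_eval (entry_var i j) x = x i j.
Proof. by rewrite /poly_eval mevalXU mxvecE. Qed.

Lemma poly_eval_sum (I : Type) (r : seq I) (P : pred I) (F : I -> mp) x :
  poly_eval (\sum_(i <- r | P i) F i) x = \sum_(i <- r | P i) poly_eval (F i) x.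
Proof. exact: (raddf_sum (meval _)). Qed.

Lemma poly_derivD p q i j :
  poly_deriv (p + q) i j = (poly_deriv p i j : mp) + poly_deriv q i j.
Proof. exact: mderivD. Qed.

Lemma poly_derivM p q i j : poly_deriv (p * q) i j =
  (poly_deriv p i j : mp) * q + p * poly_deriv q i j.
Proof. exact: mderivM. Qed.

Lemma poly_derivC c i j : poly_deriv (mpolyC _ c : mp) i j = 0.
Proof. exact: mderivC. Qed.

Lemma mxvec_index_inj i j k l :
  (mxvec_index i j == mxvec_index k l :> 'I_(d * d)) = (i == k) && (j == l).
Proof.
rewrite /mxvec_index (inj_eq (@cast_ord_inj _ _ _)) (inj_eq enum_rank_inj).
by [].
Qed.

Lemma poly_deriv_var i j k l :
  poly_deriv (entry_var k l) i j = ((k == i) && (l == j))%:R :> mp.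
Proof.
rewrite /poly_deriv /entry_var mderivX mnm1E mxvec_index_inj.
case: andP => [[/eqP -> /eqP ->]|_]; last by rewrite scale0r.
rewrite scale1r (_ : mnm_sub _ _ = mnm0) ?mpolyX0//.
by apply/mnmP => m; rewrite mnmBE subnn mnm0E.
Qed.

(** The chain rule, by induction on the polynomial, so that only sums and products of one-variable
    functions are differentiated. *)
Lemma is_derive_poly_eval p (u : K -> 'M[K]_d) (t : K) A :
  has_derivative u t A ->
  is_derive t (1 : K) (fun s => poly_eval p (u s))
    (\sum_i \sum_j A i j * poly_eval (poly_deriv p i j) (u t)).
Proof.
move=> uA; elim/entry_poly_ind: p => [c|k l|p q Hp Hq|p q Hp Hq].
- under eq_fun do rewrite poly_evalC.
  rewrite big1 => [|i _]; first exact: is_derive_const.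
  by rewrite big1// => j _; rewrite poly_derivC poly_eval0 mulr0.
- under eq_fun do rewrite poly_eval_var.
  apply: (is_derive_eq (uA k l)).
  rewrite (bigD1 k)//= (bigD1 l)//= poly_deriv_var !eqxx poly_eval1 mulr1.
  rewrite !big1 ?addr0// => [i ik|j jl]; last first.
    by rewrite poly_deriv_var eqxx/= eq_sym (negPf jl) poly_eval0 mulr0.
  by rewrite big1// => j _; rewrite poly_deriv_var eq_sym (negPf ik) poly_eval0 mulr0.
- under eq_fun do rewrite poly_evalD.
  apply: (is_derive_eq (is_derive_add Hp Hq)).
  rewrite -big_split/=; apply: eq_bigr => i _; rewrite -big_split/=.
  by apply: eq_bigr => j _; rewrite poly_derivD poly_evalD mulrDr.
- under eq_fun do rewrite poly_evalM.
  apply: (is_derive_eq (is_derive_mul Hp Hq)).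
  rewrite mulr_suml mulr_sumr -big_split/=; apply: eq_bigr => i _.
  rewrite mulr_suml mulr_sumr -big_split/=; apply: eq_bigr => j _.
  by rewrite poly_derivM poly_evalD !poly_evalM mulrDr mulrCA !mulrA.
Qed.

End EntryPolynomials.

(** * The groups preserving a bilinear form *)

Section Subspaces.
Variables (K : numFieldType) (V : lmodType K).

Definition subspace (S : set V) : Prop :=
  S 0 /\ forall (a : K) u v, S u -> S v -> S (a *: u + v).

Variables (S : set V) (Ssub : subspace S).

Lemma subspace0 : S 0. Proof. by case: Ssub. Qed.

Lemma subspaceZ a u : S u -> S (a *: u).
Proof. by move=> Su; rewrite -[_ *: _]addr0; apply: Ssub.2 => //; case: Ssub. Qed.

Lemma subspaceD u v : S u -> S v -> S (u + v).
Proof. by move=> Su Sv; rewrite -[u]scale1r; exact: Ssub.2. Qed.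

Lemma subspaceN u : S u -> S (- u).
Proof. by move=> Su; rewrite -scaleN1r; exact: subspaceZ. Qed.

Lemma subspaceB u v : S u -> S v -> S (u - v).
Proof. by move=> Su Sv; apply: subspaceD => //; exact: subspaceN. Qed.

Lemma subspace_sum (I : Type) (r : seq I) (P : pred I) (F : I -> V) :
  (forall i, P i -> S (F i)) -> S (\sum_(i <- r | P i) F i).
Proof.
move=> SF; elim/big_rec: _ => [|i u Pi Su]; first exact: subspace0.
exact/subspaceD/Su/SF.
Qed.

Lemma subspaceZK a u : a != 0 -> S (a *: u) -> S u.
Proof. by move=> a0 /(subspaceZ a^-1); rewrite scalerA mulVf// scale1r. Qed.

(* Applying [T - l k0] kills the component of eigenvalue [l k0], so induction on
   the set of remaining components separates the eigenvalues. *)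
Lemma subspace_eigen (I : finType) (T : V -> V) (v : I -> V) (l : I -> K) :
  (forall u, S u -> S (T u)) ->
  (forall c : I -> K, T (\sum_i c i *: v i) = \sum_i (c i * l i) *: v i) ->
  S (\sum_i v i) -> forall k, S (\sum_(i | l i == l k) v i).
Proof.
move=> ST Tv Sv k.
(* The coefficients [c] record the scalars accumulated by the operators [T - l j]; on the chosen
   eigenvalue they stay equal and nonzero. [s] lists the other indices that may still occur. *)
suff key (s : seq I) (c : I -> K) : S (\sum_i c i *: v i) ->
    (forall i, l i != l k -> i \notin s -> c i = 0) ->
    (forall i, l i == l k -> c i = c k) -> c k != 0 ->
    S (\sum_(i | l i == l k) v i).
  apply: (key (enum I) (fun=> 1)) => //; rewrite ?oner_eq0//.
    by under eq_bigr do rewrite scale1r.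
  by move=> i _; rewrite mem_enum.
elim: s c => [|j s IH] c Sc c0 cE ck.
  apply: (subspaceZK ck); rewrite scaler_sumr.
  suff <- : \sum_i c i *: v i = \sum_(i | l i == l k) c k *: v i by [].
  rewrite [LHS](bigID (fun i => l i == l k))/= [X in _ + X]big1 ?addr0 => [|i li].
    by apply: eq_bigr => i /cE ->.
  by rewrite c0// scale0r.
have [lj|lj] := eqVneq (l j) (l k).
  apply: (IH c) => // i li js; apply: c0 => //; rewrite inE negb_or js andbT.
  by apply: contraNneq li => ->; rewrite lj.
apply: (IH (fun i => c i * (l i - l j))).
- have -> : \sum_i (c i * (l i - l j)) *: v i =
      T (\sum_i c i *: v i) - l j *: (\sum_i c i *: v i).
    rewrite Tv scaler_sumr -sumrB; apply: eq_bigr => i _.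
    by rewrite scalerA -scalerBl mulrBr (mulrC (l j)).
  by apply: subspaceB; [exact: ST|exact: subspaceZ].
- move=> i li si; have [->|ij] := eqVneq i j; first by rewrite subrr mulr0.
  by rewrite c0 ?mul0r// inE negb_or ij.
- by move=> i li; rewrite (eqP li) cE.
- by rewrite mulf_neq0// subr_eq0 eq_sym.
Qed.

End Subspaces.

(** * The groups, their infinitesimal equations and one-parameter subgroups *)

Section FormGroup.
Variables (K : numFieldType) (d : nat).
Implicit Types (B x A N P : 'M[K]_d) (s t : K).

Definition form_group B : set 'M[K]_d :=
  [set x | \det x = 1 /\ x^T *m B *m x = B].

Definition form_lie B : set 'M[K]_d :=
  [set A | \tr A = 0 /\ A^T *m B + B *m A = 0].

Definition lie_br A N := A *m N - N *m A.

Lemma form_lie_subspace B : subspace (form_lie B).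
Proof.
split=> [|a u v [u1 u2] [v1 v2]].
  by split; rewrite ?mxtrace0// trmx0 mul0mx mulmx0 addr0.
split; first by rewrite mxtraceD mxtraceZ u1 v1 mulr0 addr0.
rewrite linearD linearZ/= mulmxDl mulmxDr -scalemxAl -scalemxAr addrACA.
by rewrite -scalerDr u2 v2 scaler0 addr0.
Qed.

Lemma form_lie_br B A N : form_lie B A -> form_lie B N -> form_lie B (lie_br A N).
Proof.
move=> [_ /eqP]; rewrite addr_eq0 => /eqP hA [_ /eqP]; rewrite addr_eq0 => /eqP hN.
split; first by rewrite linearB/= mxtrace_mulC subrr.
rewrite linearB/= !trmx_mul mulmxBl mulmxBr -!mulmxA hA hN !mulmxN.
rewrite (mulmxA N^T) (mulmxA A^T) hA hN !mulNmx !opprK -!mulmxA.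
by rewrite addrC addrA subrK subrr.
Qed.

Lemma form_group1 B : form_group B 1%:M.
Proof. by split; rewrite ?det1// trmx1 mul1mx mulmx1. Qed.

Lemma form_groupM B x y : form_group B x -> form_group B y ->
  form_group B (x *m y).
Proof.
move=> [x1 x2] [y1 y2]; split; first by rewrite det_mulmx x1 y1 mulr1.
have : y^T *m (x^T *m B *m x) *m y = B by rewrite x2.
by rewrite trmx_mul !mulmxA.
Qed.

Lemma form_group_unit B x : form_group B x -> x \in unitmx.
Proof. by move=> [x1 _]; rewrite unitmxE x1 unitr1. Qed.

Lemma form_groupV B x : form_group B x -> form_group B (invmx x).
Proof.
move=> Gx; have xu := form_group_unit Gx; case: Gx => x1 x2; split.
  by rewrite det_inv x1 invr1.
rewrite -{1}x2 trmx_inv !mulmxA mulVmx ?unitmx_tr// mul1mx -mulmxA mulmxV//.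
by rewrite mulmx1.
Qed.

(** The exponential series of [t *: N] cut after degree two, exact when [N^3 = 0]. *)
Definition exp3 N t : 'M[K]_d := 1%:M + t *: N + (t ^+ 2 / 2) *: (N *m N).

Lemma exp3D N s t : N *m N *m N = 0 -> exp3 N s *m exp3 N t = exp3 N (s + t).
Proof.
move=> N3; rewrite /exp3 !mulmxDl !mulmxDr !mul1mx !mulmx1 -!scalemxAl -!scalemxAr.
rewrite !mulmxA N3 mul0mx !scaler0 !addr0.
move: (N *m N) => M; apply/matrixP => i j; rewrite !mxE.
by field.
Qed.

Lemma exp3_0 N : exp3 N 0 = 1%:M.
Proof. by rewrite /exp3 expr0n mul0r !scale0r !addr0. Qed.

Lemma exp3_tr N B t : N^T *m B + B *m N = 0 -> (exp3 N t)^T *m B = B *m exp3 N (- t).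
Proof.
move=> /eqP; rewrite addr_eq0 => /eqP hN.
rewrite /exp3 !linearD !linearZ/= trmx1 trmx_mul !mulmxDl.
rewrite mul1mx mulmx1 -!scalemxAl -mulmxA hN mulmxN mulmxA hN.
by rewrite mulNmx opprK sqrrN scalerN scaleNr mulmxA.
Qed.

(** Over the polynomial ring [exp3] is invertible, so its determinant is a unit of [K[X]], that is,
    a constant; at [t = 0] it equals 1. *)
Lemma det_exp3 N t : N *m N *m N = 0 -> \det (exp3 N t) = 1.
Proof.
move=> N3; pose M := map_mx polyC N.
have M3 : M *m M *m M = 0 by rewrite -!map_mxM N3 map_mx0.
pose E (c : {poly K}) : 'M[{poly K}]_d :=
  1%:M + c *: M + (c ^+ 2 * (2^-1)%:P) *: (M *m M).
have E1 : E 'X *m E (- 'X) = 1%:M.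
  rewrite /E !mulmxDl !mulmxDr !mul1mx !mulmx1 -!scalemxAl -!scalemxAr.
  rewrite !mulmxA M3 mul0mx !scaler0 !addr0.
  have c2 : (2^-1)%:P + (2^-1)%:P = 1 :> {poly K}.
    by rewrite -polyCD -[RHS]/(1%:P); congr (_%:P); field.
  move: (M *m M) => Q; apply/matrixP => i j; rewrite !mxE sqrrN.
  move: (Q i j) (N i j) c2 => q m; move: (2^-1)%:P => h h2.
  rewrite [LHS](_ : _ = (i == j)%:R + 'X^2 * (h + h - 1) * q); last by ring.
  by rewrite h2 subrr mulr0 mul0r addr0.
have dE c : (\det (E 'X)).[c] = \det (exp3 N c).
  rewrite -horner_evalE -det_map_mx; congr (\det _); apply/matrixP => i j.
  rewrite /E /M -map_mxM !mxE /= !horner_evalE !hornerE; congr (_ + _ + _).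
  by case: (i == j); rewrite hornerE.
have : \det (E 'X) \is a GRing.unit.
  by apply/unitrPr; exists (\det (E (- 'X))); rewrite -det_mulmx E1 det1.
rewrite poly_unitE => /andP[/size_poly1P [c _ dc] _].
have := dE 0; rewrite exp3_0 det1 dc hornerC => c1.
by rewrite -dE dc hornerC c1.
Qed.

Lemma exp3_form_group B N t : form_lie B N -> N *m N *m N = 0 ->
  form_group B (exp3 N t).
Proof.
move=> [_ NB] N3; split; first exact: det_exp3.
by rewrite (exp3_tr _ NB) -mulmxA exp3D// addNr exp3_0 mulmx1.
Qed.

Lemma has_derivative_exp3 N t : N *m N *m N = 0 ->
  has_derivative (exp3 N) t (exp3 N t *m N).
Proof.
move=> N3; have -> : exp3 N t *m N = 0 + 1 *: N + t *: (N *m N).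
  rewrite /exp3 !mulmxDl mul1mx -!scalemxAl N3 scaler0 addr0.
  by rewrite add0r scale1r.
apply: has_derivative_add; first apply: has_derivative_add.
- exact: has_derivative_cst.
- by apply: has_derivative_scale; exact: is_derive_id.
- apply: has_derivative_scale.
  have := is_derive_scale 2^-1 (is_derive_mul (is_derive_id t 1) (is_derive_id t 1)).
  rewrite mul1r mulr1 /=; under eq_fun do rewrite -expr2 mulrC.
  by move=> /is_derive_eq; apply; rewrite /=; field.
Qed.

Definition conj_diag P (l : 'I_d -> K) : 'M[K]_d :=
  P *m diag_mx (\row_k l k) *m invmx P.

Lemma mulmx_diagE (l : 'I_d -> K) A i j :
  (diag_mx (\row_k l k) *m A) i j = l i * A i j.
Proof. by rewrite mul_diag_mx !mxE. Qed.

Lemma mulmx_diagEr (l : 'I_d -> K) A i j :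
  (A *m diag_mx (\row_k l k)) i j = A i j * l j.
Proof. by rewrite mul_mx_diag !mxE. Qed.

Lemma tr_conj_diag P l : P \in unitmx -> \tr (conj_diag P l) = \sum_k l k.
Proof.
move=> Pu; rewrite /conj_diag mxtrace_mulC mulmxA mulVmx// mul1mx mxtrace_diag.
by apply: eq_bigr => i _; rewrite mxE.
Qed.

Lemma det_conj_diag P l : P \in unitmx -> \det (conj_diag P l) = \prod_k l k.
Proof.
move=> Pu; rewrite /conj_diag !det_mulmx det_inv det_diag mulrAC divff ?mul1r.
  by apply: eq_bigr => i _; rewrite mxE.
by rewrite -unitfE -unitmxE.
Qed.

(** In the basis of the columns of [P] the form has Gram matrix [P^T B P], and the condition on [B]
    says that only vectors of opposite weights may pair nontrivially. *)
Lemma form_lie_conj_diag B P l : P \in unitmx ->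
  (form_lie B (conj_diag P l) <->
   \sum_k l k = 0 /\ forall i j, (l i + l j) * (P^T *m B *m P) i j = 0).
Proof.
move=> Pu; rewrite /form_lie/= tr_conj_diag//.
have PB : P^T *m ((conj_diag P l)^T *m B + B *m conj_diag P l) *m P =
  diag_mx (\row_k l k) *m (P^T *m B *m P) + P^T *m B *m P *m diag_mx (\row_k l k).
  rewrite mulmxDr mulmxDl /conj_diag !trmx_mul tr_diag_mx !mulmxA.
  by rewrite -trmx_mul mulVmx// trmx1 mul1mx mulmxKV.
have lJ i j : (diag_mx (\row_k l k) *m (P^T *m B *m P) +
    P^T *m B *m P *m diag_mx (\row_k l k)) i j =
    (l i + l j) * (P^T *m B *m P) i j.
  by rewrite [LHS]mxE mulmx_diagE mulmx_diagEr mulrDl (mulrC (l j)).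
split=> -[l0 lB]; split => //.
  by move=> i j; rewrite -lJ -PB lB mulmx0 mul0mx mxE.
have PB0 : P^T *m ((conj_diag P l)^T *m B + B *m conj_diag P l) *m P = 0.
  by rewrite PB; apply/matrixP => i j; rewrite lJ lB mxE.
have : invmx P^T *m (P^T *m ((conj_diag P l)^T *m B + B *m conj_diag P l) *m P)
  *m invmx P = 0 by rewrite PB0 mulmx0 mul0mx.
by rewrite -mulmxA mulmxK// mulKmx// unitmx_tr.
Qed.

Lemma conj_diag_form_group (ex : K -> K) B P l t : is_exponential ex ->
  P \in unitmx -> form_lie B (conj_diag P l) ->
  form_group B (conj_diag P (fun k => ex (l k * t))).
Proof.
move=> [ex0 exD _] Pu /(form_lie_conj_diag B l Pu) [l0 lB]; split.
  rewrite det_conj_diag// -[RHS]ex0 -(mul0r t) -l0 mulr_suml.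
  by elim/big_rec2: _ => [|i a b _ ->]; rewrite ?ex0 ?exD.
set D := diag_mx (\row_k ex (l k * t)).
have DPD : D *m (P^T *m B *m P) *m D = P^T *m B *m P.
  apply/matrixP => i j; rewrite mulmx_diagEr mulmx_diagE.
  have /eqP := lB i j; rewrite mulf_eq0 => /orP[/eqP lij|/eqP ->]; last first.
    by rewrite mulr0 mul0r.
  by rewrite mulrAC -exD -mulrDl lij mul0r ex0 mul1r.
have -> : (conj_diag P (fun k => ex (l k * t)))^T *m B *m
    conj_diag P (fun k => ex (l k * t)) =
    invmx P^T *m (D *m (P^T *m B *m P) *m D) *m invmx P.
  by rewrite /conj_diag !trmx_mul tr_diag_mx trmx_inv !mulmxA.
by rewrite DPD -mulmxA mulmxK// mulKmx// unitmx_tr.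
Qed.

Lemma has_derivative_conj_diag (ex : K -> K) P l t : is_exponential ex ->
  P \in unitmx ->
  has_derivative (fun s => conj_diag P (fun k => ex (l k * s))) t
    (conj_diag P (fun k => ex (l k * t)) *m conj_diag P l).
Proof.
move=> hex Pu; rewrite /conj_diag !mulmxA mulmxKV//.
apply: has_derivative_mulr.
rewrite -mulmxA; apply: has_derivative_mull => i j.
rewrite mulmx_diagE !mxE; under eq_fun do rewrite !mxE.
case: eqVneq => [->|ij]; last by rewrite !mulr0n mulr0; exact: is_derive_const.
by rewrite !mulr1n mulrC; exact: is_derive_exponentialZ.
Qed.

End FormGroup.

(** * Tangent vectors at the identity *)

Section LieAlgebra.
Variables (K : numFieldType) (d : nat) (B : 'M[K]_d).
Local Notation G := (form_group B).
Implicit Types (A N x : 'M[K]_d).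

(** Both equations of the group hold along the curve near 0, so their derivatives at 0 vanish. *)
Lemma lie_algebra_form A : lie_algebra G A -> form_lie B A.
Proof.
move=> [u [Gu u0 uA]].
have Gu1 : \forall t \near (0 : K), \det (u t) = 1.
  by apply: filterS Gu => t [[]].
have Gu2 : \forall t \near (0 : K), (u t)^T *m B *m u t = B.
  by apply: filterS Gu => t [[]].
split.
  have dA := is_derive_det u0 uA.
  have := near_eq_is_derive Gu1 dA; rewrite /= => -[_ <-].
  by case: (is_derive_const (0 : K) (1 : K)).
have dA := has_derivative_mul (has_derivative_mulr B (has_derivative_tr uA)) uA.
rewrite u0 trmx1 mul1mx mulmx1 in dA.
apply: (@has_derivative_unique _ _ 0 (fun=> B)); last exact: has_derivative_cst.
move=> i j; apply: near_eq_is_derive (dA i j).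
by apply: filterS Gu2 => t ->.
Qed.

(** Sums of curves leave the group; the product [u (a * t) *m v t] stays in it and adds the
    velocities. *)
Lemma lie_algebra_subspace : subspace (lie_algebra G).
Proof.
split=> [|a A N [u [Gu u0 uA]] [v [Gv v0 vN]]].
  exists (fun=> 1%:M); split=> //; last exact: has_derivative_cst.
  near=> t; split; first exact: form_group1.
  by exists 0; exact: has_derivative_cst.
exists (fun t => u (a * t) *m v t); split.
- have Gau : \forall t \near (0 : K),
      G (u (a * t)) /\ exists A', has_derivative u (a * t) A'.
    have cvga : (fun t => a * t) @ (0 : K) --> (0 : K).
      by rewrite -[X in _ --> X](mulr0 a); exact: mulrl_continuous.
    exact: cvga Gu.
  near=> t.
  have [Gut [A' uA']] : G (u (a * t)) /\ exists A', has_derivative u (a * t) A'.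
    by near: t.
  have [Gvt [N' vN']] : G (v t) /\ exists A', has_derivative v t A' by near: t.
  split; first exact: form_groupM.
  eexists; apply: has_derivative_mul; last exact: vN'.
  exact: has_derivative_compZ uA'.
- by rewrite mulr0 u0 v0 mulmx1.
have uA0 : has_derivative u (a * 0) A by rewrite mulr0.
have := has_derivative_mul (has_derivative_compZ uA0) vN.
by rewrite mulr0 u0 v0 mulmx1 mul1mx.
Unshelve. all: by end_near. Qed.

(** With the span condition [gen_nilpotent] this yields the converse of [lie_algebra_form] without
    any general matrix exponential. *)
Lemma lie_algebra_nilpotent N :
  form_lie B N -> N *m N *m N = 0 -> lie_algebra G N.
Proof.
move=> BN N3; exists (exp3 N); split; last 2 first.
- exact: exp3_0.
- by have := has_derivative_exp3 0 N3; rewrite exp3_0 mul1mx.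
near=> t; split; first exact: exp3_form_group.
by exists (exp3 N t *m N); exact: has_derivative_exp3.
Unshelve. all: by end_near. Qed.

Lemma lie_algebra_conj x A :
  G x -> lie_algebra G A -> lie_algebra G (invmx x *m A *m x).
Proof.
move=> Gx [u [Gu u0 uA]].
exists (fun t => invmx x *m u t *m x); split; last 2 first.
- by rewrite u0 mulmx1 mulVmx// (form_group_unit Gx).
- exact/has_derivative_mulr/has_derivative_mull.
apply: filterS Gu => t [Gut [A' uA']]; split.
  by apply/form_groupM => //; apply: form_groupM => //; exact: form_groupV.
by exists (invmx x *m A' *m x); exact/has_derivative_mulr/has_derivative_mull.
Qed.

End LieAlgebra.

(** * Polynomial vector fields and their brackets *)

Section PolynomialFields.
Variables (K : numFieldType) (d : nat) (B : 'M[K]_d).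
Local Notation G := (form_group B).
Local Notation mp := (mpoly (d * d) K).
Implicit Types (x : 'M[K]_d) (v w : 'M[mp]_d) (p q : mp).
Hypothesis lieG : forall A, lie_algebra G A <-> form_lie B A.

Definition mx_eval x m n (v : 'M[mp]_(m, n)) : 'M[K]_(m, n) :=
  map_mx (fun p => poly_eval p x) v.

(** Polynomial fields are handled through matrices of polynomials, on which brackets are computed
    formally. Different matrices may represent the same field, since polynomials may agree on [G]
    only. *)
Definition field_of v : matrix_field G := fun x : G => mx_eval (val x) v.

Definition der v p : mp := \sum_i \sum_j v i j * poly_deriv p i j.

Definition tangent v : Prop :=
  forall x, G x -> form_lie B (invmx x *m mx_eval x v).

Definition br v w : 'M[mp]_d := \matrix_(i, j) (der v (w i j) - der w (v i j)).

Lemma G_val (x : G) : G (val x). Proof. exact: set_mem (valP x). Qed.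

Lemma G_in x : G x -> exists y : G, val y = x.
Proof. by move=> Gx; exists (exist _ x (mem_set Gx)). Qed.

Lemma X_algP (V : matrix_field G) :
  X_alg G V <-> exists2 v, tangent v & V = field_of v.
Proof.
split=> [[VV Vp]|[v tv ->]]; last first.
  split=> [x|i j]; last by exists (v i j) => x; rewrite mxE.
  exists (invmx (val x) *m mx_eval (val x) v); first exact/lieG/tv/G_val.
  by rewrite mulKVmx// (form_group_unit (G_val x)).
have /choice [f fE] : forall ij : 'I_d * 'I_d, exists p : mp, forall x : G,
    V x ij.1 ij.2 = poly_eval p (val x) by move=> [i j]; exact: Vp.
have VE : V = field_of (\matrix_(i, j) f (i, j)).
  by apply/funext => x; apply/matrixP => i j; rewrite !mxE (fE (i, j)).
exists (\matrix_(i, j) f (i, j)) => // x Gx.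
have [y <-] := G_in Gx; have [A lA VA] := VV y.
rewrite -[mx_eval _ _]/(field_of _ y) -VE VA mulKmx; first exact/lieG.
exact: form_group_unit (G_val y).
Qed.

Lemma act_field_of v p (x : G) : act (field_of v) p x = poly_eval (der v p) (val x).
Proof.
rewrite /der poly_eval_sum; apply: eq_bigr => i _; rewrite poly_eval_sum.
by apply: eq_bigr => j _; rewrite poly_evalM mxE.
Qed.

Lemma derD v p q : der v (p + q) = der v p + der v q.
Proof.
rewrite /der -big_split/=; apply: eq_bigr => i _; rewrite -big_split/=.
by apply: eq_bigr => j _; rewrite poly_derivD mulrDr.
Qed.

Lemma derM v p q : der v (p * q) = der v p * q + p * der v q.
Proof.
rewrite /der mulr_suml mulr_sumr -big_split/=; apply: eq_bigr => i _.
rewrite mulr_suml mulr_sumr -big_split/=; apply: eq_bigr => j _.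
by rewrite poly_derivM mulrDr !mulrA (mulrC (v i j) p).
Qed.

Lemma derC v c : der v (mpolyC _ c) = 0.
Proof.
by rewrite /der big1// => i _; rewrite big1// => j _; rewrite poly_derivC mulr0.
Qed.

Lemma derZ v c p : der v (c *: p) = c *: der v p.
Proof. by rewrite -!mul_mpolyC derM derC mul0r add0r. Qed.

Lemma der0 v : der v 0 = 0.
Proof. by rewrite -(mpolyC0 (d * d) K) derC mpolyC0. Qed.

Lemma derN v p : der v (- p) = - der v p.
Proof. by rewrite -scaleN1r derZ scaleN1r. Qed.

Lemma derB v p q : der v (p - q) = der v p - der v q.
Proof. by rewrite derD derN. Qed.

Lemma der_sum v (I : Type) (r : seq I) (P : pred I) (F : I -> mp) :
  der v (\sum_(i <- r | P i) F i) = \sum_(i <- r | P i) der v (F i).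
Proof. by elim/big_rec2: _ => [|i p q _ <-]; rewrite ?der0 ?derD. Qed.

Lemma der_var v i j : der v (entry_var K i j) = v i j.
Proof.
rewrite /der (bigD1 i)//= (bigD1 j)//= poly_deriv_var !eqxx mulr1.
rewrite !big1 ?addr0// => [k ki|l lj]; last first.
  by rewrite poly_deriv_var eqxx/= eq_sym (negPf lj) mulr0.
by rewrite big1// => l _; rewrite poly_deriv_var eq_sym (negPf ki) mulr0.
Qed.

Lemma derMl q v p : der (q *: v) p = q * der v p.
Proof.
rewrite /der mulr_sumr; apply: eq_bigr => i _; rewrite mulr_sumr.
by apply: eq_bigr => j _; rewrite mxE mulrA.
Qed.

(** The second-order terms of the commutator cancel, so both sides are derivations; they agree on
    coordinates by the definition of [br]. *)
Lemma der_br v w p : der (br v w) p = der v (der w p) - der w (der v p).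
Proof.
elim/entry_poly_ind: p => [c|i j|p q Hp Hq|p q Hp Hq].
- by rewrite !derC ?der0 subrr.
- by rewrite !der_var mxE.
- by rewrite !derD Hp Hq opprD addrACA.
- by rewrite !derM !derD !derM Hp Hq; ring.
Qed.

(* A tangent derivation differentiates along curves lying in [G]. *)
Lemma der_vanish v p : tangent v -> (forall x, G x -> poly_eval p x = 0) ->
  forall x, G x -> poly_eval (der v p) x = 0.
Proof.
move=> tv p0 x Gx; have /lieG [u [Gu u0 uA]] := tv _ Gx.
have xA := has_derivative_mull x uA.
rewrite mulKVmx ?(form_group_unit Gx)// in xA.
have := is_derive_poly_eval p xA; rewrite u0 mulmx1 => dp.
have p0u : \forall t \near (0 : K), poly_eval p (x *m u t) = 0.
  by apply: filterS Gu => t [Gut _]; apply/p0/form_groupM.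
have := near_eq_is_derive p0u dp; rewrite /= => -[_].
case: (is_derive_const (0 : K) (0 : K)) => _ -> dE.
rewrite /der poly_eval_sum [RHS]dE; apply: eq_bigr => i _; rewrite poly_eval_sum.
by apply: eq_bigr => j _; rewrite poly_evalM mxE.
Qed.

Lemma der_congr v p q : tangent v ->
  (forall x, G x -> poly_eval p x = poly_eval q x) ->
  forall x, G x -> poly_eval (der v p) x = poly_eval (der v q) x.
Proof.
move=> tv pq x Gx; apply/eqP; rewrite -subr_eq0 -poly_evalB -derB; apply/eqP.
by apply: der_vanish Gx => // y Gy; rewrite poly_evalB pq// subrr.
Qed.

(** The straight line leaves [G] but stays in the matrix space, where polynomials live. It turns
    [der] into a directional derivative before [v] is known to be tangent. *)
Lemma poly_eval_line v p x :
  is_derive (0 : K) (1 : K) (fun s => poly_eval p (x + s *: mx_eval x v))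
    (poly_eval (der v p) x).
Proof.
have dl : has_derivative (fun s => x + s *: mx_eval x v) 0 (0 + 1 *: mx_eval x v).
  apply: has_derivative_add; first exact: has_derivative_cst.
  by apply: has_derivative_scale; exact: is_derive_id.
apply: (is_derive_eq (is_derive_poly_eval p dl)).
rewrite /der poly_eval_sum scale0r addr0; apply: eq_bigr => i _.
rewrite poly_eval_sum; apply: eq_bigr => j _.
by rewrite add0r scale1r mxE poly_evalM.
Qed.

Definition entry_mx : 'M[mp]_d := \matrix_(i, j) entry_var K i j.

Lemma mx_evalM m n l (v : 'M[mp]_(m, n)) (w : 'M[mp]_(n, l)) x :
  mx_eval x (v *m w) = mx_eval x v *m mx_eval x w.
Proof. exact: (map_mxM (meval _)). Qed.

Lemma mx_eval_tr v x : mx_eval x v^T = (mx_eval x v)^T.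
Proof. by rewrite /mx_eval map_trmx. Qed.

Lemma mx_eval_entry x : mx_eval x entry_mx = x.
Proof. by apply/matrixP => i j; rewrite !mxE poly_eval_var. Qed.

Lemma mx_evalC (A : 'M[K]_d) x : mx_eval x (map_mx (@mpolyC (d * d) K) A) = A.
Proof. by apply/matrixP => i j; rewrite !mxE poly_evalC. Qed.

Lemma poly_eval_det x : poly_eval (\det entry_mx) x = \det x.
Proof. by rewrite /poly_eval -det_map_mx -[in RHS](mx_eval_entry x). Qed.

Definition form_poly : 'M[mp]_d :=
  entry_mx^T *m map_mx (@mpolyC (d * d) K) B *m entry_mx.

Lemma mx_eval_form x : mx_eval x form_poly = x^T *m B *m x.
Proof. by rewrite !mx_evalM mx_eval_tr mx_evalC mx_eval_entry. Qed.

(* The converse of [der_vanish] for the equations of [G]. *)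
Lemma tangentP v : (forall p, (forall x, G x -> poly_eval p x = 0) ->
    forall x, G x -> poly_eval (der v p) x = 0) -> tangent v.
Proof.
move=> v0 x Gx; have xu := form_group_unit Gx; set C := mx_eval x v.
split.
  have : poly_eval (der v (\det entry_mx - 1)) x = 0.
    apply: v0 => // y [y1 _]; rewrite poly_evalB poly_eval_det y1.
    by rewrite poly_eval1 subrr.
  rewrite derB -[1]/(mpolyC (d * d) 1) derC subr0 => d0.
  have := poly_eval_line v (\det entry_mx) x; rewrite d0.
  under eq_fun do rewrite poly_eval_det.
  have -> : (fun s => \det (x + s *: mx_eval x v)) =
      (fun s => \det (1%:M + s *: (invmx x *m C))).
    apply/funext => s; rewrite -[RHS]mul1r -{1}(proj1 Gx) -det_mulmx mulmxDr.
    by rewrite mulmx1 -scalemxAr mulKVmx.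
  move=> [_ <-].
  have dl : has_derivative (fun s => 1%:M + s *: (invmx x *m C)) 0
      (0 + 1 *: (invmx x *m C)).
    apply: has_derivative_add; first exact: has_derivative_cst.
    by apply: has_derivative_scale; exact: is_derive_id.
  rewrite scale1r add0r in dl.
  have l0 : 1%:M + 0 *: (invmx x *m C) = 1%:M by rewrite scale0r addr0.
  by case: (is_derive_det l0 dl).
have xBC : C^T *m B *m x + x^T *m B *m C = 0.
  have dl : has_derivative (fun s => x + s *: C) 0 (0 + 1 *: C).
    apply: has_derivative_add; first exact: has_derivative_cst.
    by apply: has_derivative_scale; exact: is_derive_id.
  rewrite scale1r add0r in dl.
  have := has_derivative_mul (has_derivative_mulr B (has_derivative_tr dl)) dl.
  rewrite scale0r addr0 => dB; apply: has_derivative_unique dB _ => i j.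
  have := poly_eval_line v (form_poly i j) x.
  have -> : poly_eval (der v (form_poly i j)) x = 0.
    rewrite -[form_poly i j](subrK (mpolyC _ (B i j))) derD derC addr0.
    apply: v0 => // y [_ yB]; rewrite poly_evalB poly_evalC -[in X in _ - X]yB.
    by rewrite -mx_eval_form [in X in _ - X]mxE subrr.
  rewrite (_ : (fun s => _) = fun s => ((x + s *: C)^T *m B *m (x + s *: C)) i j).
    by move=> /is_derive_eq; apply; rewrite mxE.
  by apply/funext => s; rewrite -mx_eval_form [RHS]mxE.
have CA : C = x *m (invmx x *m C) by rewrite mulKVmx.
move: xBC; rewrite CA; set A := invmx x *m C; rewrite mulKmx//.
have -> : (x *m A)^T *m B *m x + x^T *m B *m (x *m A) =
    A^T *m (x^T *m B *m x) + (x^T *m B *m x) *m A.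
  by rewrite trmx_mul !mulmxA.
by rewrite (proj2 Gx).
Qed.

(** Tangency amounts to preserving the polynomials that vanish on [G], and a commutator of two such
    derivations preserves them too. *)
Lemma tangent_br v w : tangent v -> tangent w -> tangent (br v w).
Proof.
move=> tv tw; apply: tangentP => p p0 x Gx; rewrite der_br poly_evalB.
have vp := der_vanish tv p0; have wp := der_vanish tw p0.
by rewrite (der_vanish tv wp)// (der_vanish tw vp)// subrr.
Qed.

(** The representatives [q] and [r] are given only up to polynomials vanishing on [G]; tangency
    makes their derivatives insensitive to this choice. *)
Lemma is_lie_bracket_field v w : tangent v -> tangent w ->
  is_lie_bracket (field_of v) (field_of w) (field_of (br v w)).
Proof.
move=> tv tw p q r qE rE x; rewrite !act_field_of der_br poly_evalB.
congr (_ - _); apply: der_congr (G_val x) => // y Gy; have [z <-] := G_in Gy.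
  by rewrite qE act_field_of.
by rewrite rE act_field_of.
Qed.

Lemma is_lie_bracket_eq v w (U : matrix_field G) :
  is_lie_bracket (field_of v) (field_of w) U -> U = field_of (br v w).
Proof.
move=> vwU; apply/funext => x; apply/matrixP => i j.
have := vwU (entry_var K i j) (w i j) (v i j).
rewrite !mxE poly_evalB -!act_field_of => <-; first last.
- by move=> y; rewrite act_field_of der_var.
- by move=> y; rewrite act_field_of der_var.
rewrite /act (bigD1 i)//= (bigD1 j)//= poly_deriv_var !eqxx poly_eval1 mulr1.
rewrite !big1 ?addr0// => [k ki|l lj]; last first.
  by rewrite poly_deriv_var eqxx/= eq_sym (negPf lj) poly_eval0 mulr0.
rewrite big1// => l _; rewrite poly_deriv_var eq_sym (negPf ki).
by rewrite poly_eval0 mulr0.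
Qed.

Lemma X_alg_lie_subalgebra : lie_subalgebra (X_alg G).
Proof.
have E0 x : mx_eval x (0 : 'M[mp]_d) = 0.
  by apply/matrixP => i j; rewrite !mxE poly_eval0.
split=> //.
- apply/X_algP; exists 0.
    by move=> x Gx; rewrite E0 mulmx0; exact: (form_lie_subspace B).1.
  by apply/funext => x; rewrite /field_of E0.
- move=> a V W /X_algP [v tv ->] /X_algP [w tw ->]; apply/X_algP.
  have E x : mx_eval x (map_mx (@mpolyC (d * d) K) a%:M *m v + w) =
      a *: mx_eval x v + mx_eval x w.
    rewrite -mul_scalar_mx -[in RHS](mx_evalC a%:M x) -mx_evalM.
    by apply/matrixP => i j; rewrite !mxE poly_evalD.
  exists (map_mx (@mpolyC (d * d) K) a%:M *m v + w).
    move=> x Gx; rewrite E mulmxDr -scalemxAr.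
    by apply: (form_lie_subspace B).2; [exact: tv|exact: tw].
  by apply/funext => x; rewrite /field_of E.
- move=> V W U /X_algP [v tv ->] /X_algP [w tw ->] /is_lie_bracket_eq ->.
  by apply/X_algP; exists (br v w) => //; exact: tangent_br.
Qed.

End PolynomialFields.

(** * Multiples of left-invariant fields *)

(** The cancellation behind [inL_triple], with iterated derivatives as independent ring elements:
    [AA'h] stands for [A (A' h)], [eAC] for the field of [[A, C]], and [e1], [e2] for those of [[A,
    [A', C]]] and [[A', [A, C]]]. *)
Lemma triple_identity (R : comNzRingType) (m n : nat)
  (f h Af A'f Cf Ah A'h AA'h A'Ah ACf A'Cf CAf CA'f : R)
  (eA eA' eC eAC eA'C eAA' e1 e2 : 'M[R]_(m, n)) :
  - ((f * AA'h) *: eC - (A'h * Cf) *: eA + (f * A'h) *: eAC +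
     ((f * Ah) *: eA'C - (h * (A'Cf - CA'f)) *: eA + (f * h) *: e1) -
     ((f * A'Ah) *: eC - (Ah * Cf) *: eA' + (f * Ah) *: eA'C) -
     ((f * A'h) *: eAC - (h * (ACf - CAf)) *: eA' + (f * h) *: e2) -
     ((f * (AA'h - A'Ah)) *: eC - (h * Cf) *: eAA' + (f * h) *: (e1 - e2)) +
     ((Cf * A'h) *: eA - (h * ACf) *: eA' + (Cf * h) *: - eAA') -
     ((Cf * Ah) *: eA' - (h * A'Cf) *: eA + (Cf * h) *: eAA')) =
  (CAf * h) *: eA' - (CA'f * h) *: eA + (Cf * h) *: eAA'.
Proof. by apply/matrixP => i j; rewrite !mxE; ring. Qed.

Lemma scale_identity (R : comNzRingType) (f h vh wf vw wv vij wij : R) :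
  f * (vh * wij + h * vw) - h * (wf * vij + f * wv) =
  f * vh * wij - h * wf * vij + f * h * (vw - wv).
Proof. by ring. Qed.

Lemma subrKl (V : zmodType) (u a b : V) : u + a - (u + b) = a - b.
Proof. by rewrite opprD addrACA subrr add0r. Qed.

Section LinearFields.
Variables (K : numFieldType) (d : nat) (B : 'M[K]_d).
Local Notation G := (form_group B).
Local Notation mp := (mpoly (d * d) K).
Local Notation X := (entry_mx K d).
Local Notation fld := (@field_of K d B).
Implicit Types (A C N : 'M[K]_d) (v w : 'M[mp]_d) (p q f h : mp).
Hypothesis lieG : forall A, lie_algebra G A <-> form_lie B A.

Definition cst_mx m n (A : 'M[K]_(m, n)) : 'M[mp]_(m, n) :=
  map_mx (@mpolyC (d * d) K) A.

Lemma cst_mxM m n l (A : 'M[K]_(m, n)) (C : 'M[K]_(n, l)) :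
  cst_mx (A *m C) = cst_mx A *m cst_mx C.
Proof. exact: map_mxM. Qed.

Lemma cst_mxD m n (A C : 'M[K]_(m, n)) : cst_mx (A + C) = cst_mx A + cst_mx C.
Proof. exact: map_mxD. Qed.

Lemma cst_mxB m n (A C : 'M[K]_(m, n)) : cst_mx (A - C) = cst_mx A - cst_mx C.
Proof. exact: map_mxB. Qed.

Lemma cst_mxZ m n a (A : 'M[K]_(m, n)) : cst_mx (a *: A) = mpolyC _ a *: cst_mx A.
Proof. exact: map_mxZ. Qed.

Lemma cst_mx0 m n : cst_mx (0 : 'M[K]_(m, n)) = 0.
Proof. exact: map_mx0. Qed.

Lemma cst_mx1 : cst_mx (1%:M : 'M[K]_d) = 1%:M.
Proof. exact: map_mx1. Qed.

Lemma mxDE m n (U W : 'M[mp]_(m, n)) i j : (U + W) i j = U i j + W i j.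
Proof. by rewrite mxE. Qed.

Lemma mxBE m n (U W : 'M[mp]_(m, n)) i j : (U - W) i j = U i j - W i j.
Proof. by rewrite mxE [X in _ + X]mxE. Qed.

(* The left-invariant vector field of [A], multiplied by the function [p]. *)
Definition lf p A : 'M[mp]_d := p *: (X *m cst_mx A).

Definition DD A p : mp := der (X *m cst_mx A) p.

Lemma lfE p A i j : lf p A i j = p * (X *m cst_mx A) i j.
Proof. by rewrite mxE. Qed.

Lemma lfDl p q A : lf (p + q) A = lf p A + lf q A.
Proof. exact: scalerDl. Qed.

Lemma lfDr p A C : lf p (A + C) = lf p A + lf p C.
Proof. by rewrite /lf cst_mxD mulmxDr scalerDr. Qed.

Lemma lfZr p a A : lf p (a *: A) = lf (a *: p) A.
Proof. by rewrite /lf cst_mxZ -scalemxAr scalerA -mul_mpolyC mulrC. Qed.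

Lemma lfZl p a A : lf (a *: p) A = mpolyC _ a *: lf p A.
Proof. by rewrite /lf -mul_mpolyC -scalerA. Qed.

Lemma lf0l A : lf 0 A = 0.
Proof. exact: scale0r. Qed.

Lemma lf0r p : lf p 0 = 0.
Proof. by rewrite /lf cst_mx0 mulmx0 scaler0. Qed.

Lemma mx_eval_lf p A x : mx_eval x (lf p A) = poly_eval p x *: (x *m A).
Proof.
have -> : x *m A = mx_eval x (X *m cst_mx A).
  by rewrite mx_evalM mx_eval_entry mx_evalC.
apply/matrixP => i j; rewrite mxE lfE poly_evalM [RHS]mxE; congr (_ * _).
by rewrite [RHS]mxE.
Qed.

Lemma tangent_lf p A : form_lie B A -> tangent B (lf p A).
Proof.
move=> gA x Gx; rewrite mx_eval_lf -scalemxAr mulKmx ?(form_group_unit Gx)//.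
exact: (subspaceZ (form_lie_subspace B) _ gA).
Qed.

Lemma der_mx v m n (A : 'M[K]_(m, d)) (C : 'M[K]_(d, n)) i j :
  der v ((cst_mx A *m X *m cst_mx C) i j) = (cst_mx A *m v *m cst_mx C) i j.
Proof.
rewrite mxE der_sum [RHS]mxE; apply: eq_bigr => k _.
rewrite derM [X in _ * der _ X]mxE derC mulr0 addr0; congr (_ * _).
rewrite !mxE der_sum; apply: eq_bigr => k' _.
by rewrite !mxE derM derC mul0r add0r der_var.
Qed.

Lemma der_mulr v n (C : 'M[K]_(d, n)) i j :
  der v ((X *m cst_mx C) i j) = (v *m cst_mx C) i j.
Proof. by have := der_mx v 1%:M C i j; rewrite cst_mx1 !mul1mx. Qed.

Lemma der_mull v m (A : 'M[K]_(m, d)) i j :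
  der v ((cst_mx A *m X) i j) = (cst_mx A *m v) i j.
Proof. by have := der_mx v A 1%:M i j; rewrite cst_mx1 !mulmx1. Qed.

Lemma DD1 A : DD A 1 = 0.
Proof. by rewrite /DD -(mpolyC1 (d * d) K) derC. Qed.

Lemma DD_br A C p : DD (lie_br A C) p = DD A (DD C p) - DD C (DD A p).
Proof.
rewrite /DD -der_br; congr (der _ _); apply/matrixP => i j.
rewrite [RHS]mxE !der_mulr -!mulmxA -!cst_mxM.
by rewrite /lie_br cst_mxB mulmxBr mxBE.
Qed.

Lemma br_scale f v h w : br (f *: v) (h *: w) =
  (f * der v h) *: w - (h * der w f) *: v + (f * h) *: br v w.
Proof.
apply/matrixP => i j; rewrite !mxE !derMl !derM.
move: (der v h) (der w f) (der v (w i j)) (der w (v i j)) => vh wf vw wv.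
move: (v i j) (w i j) => vij wij.
exact: scale_identity.
Qed.

Lemma br_entry A C : br (X *m cst_mx A) (X *m cst_mx C) = X *m cst_mx (lie_br A C).
Proof.
apply/matrixP => i j; rewrite mxE !der_mulr -!mulmxA -!cst_mxM -mxBE -mulmxBr.
by rewrite -cst_mxB.
Qed.

Lemma br_lf f A h C : br (lf f A) (lf h C) =
  lf (f * DD A h) C - lf (h * DD C f) A + lf (f * h) (lie_br A C).
Proof. by rewrite /lf br_scale br_entry. Qed.

Definition bi_field A C : 'M[mp]_d := cst_mx A *m X + X *m cst_mx C.

(** The right-invariant part [A X] commutes with left-invariant fields, so only [C] contributes. *)
Lemma br_bi A C N : br (bi_field A C) (X *m cst_mx N) = X *m cst_mx (lie_br C N).
Proof.
apply/matrixP => i j; rewrite mxE der_mulr [bi_field A C i j]mxDE derD.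
rewrite der_mulr der_mull -mxDE -mxBE; congr (fun_of_matrix _ i j).
rewrite mulmxDl !mulmxA subrKl.
by rewrite -!mulmxA -!cst_mxM -mulmxBr -cst_mxB.
Qed.

Lemma br_bi_lf A C p N :
  br (bi_field A C) (lf p N) = lf (der (bi_field A C) p) N + lf p (lie_br C N).
Proof.
rewrite -[bi_field A C in LHS]scale1r /lf br_scale br_bi !mul1r.
by rewrite -(mpolyC1 (d * d) K) derC mulr0 scale0r subr0.
Qed.

Lemma mx_evalD m n (v w : 'M[mp]_(m, n)) x :
  mx_eval x (v + w) = mx_eval x v + mx_eval x w.
Proof. by apply/matrixP => i j; rewrite !mxE poly_evalD. Qed.

Lemma mx_eval_bi A C x : mx_eval x (bi_field A C) = A *m x + x *m C.
Proof.
by rewrite /bi_field mx_evalD !mx_evalM mx_eval_entry !mx_evalC.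
Qed.

(** Writing [A x = x (x^-1 A x)] reduces the right-invariant part to stability of the Lie algebra
    under conjugation, which is clear for velocities of curves. *)
Lemma tangent_bi A C : form_lie B A -> form_lie B C -> tangent B (bi_field A C).
Proof.
move=> /lieG gA gC x Gx; rewrite mx_eval_bi mulmxDr mulKmx ?(form_group_unit Gx)//.
by apply: (subspaceD (form_lie_subspace B)) => //; apply/lieG; rewrite mulmxA;
   exact: lie_algebra_conj.
Qed.

Section Subalgebra.
Variable (L : set (matrix_field G)).
Hypothesis Lsub : lie_subalgebra L.

Definition inL v : Prop := L (fld v).

Lemma inL_tangent v : inL v -> tangent B v.
Proof.
case: Lsub => + _ _ _ => /[apply] /(X_algP lieG) [w tw vw] x Gx.
have [y <-] := G_in Gx; have := tw _ (G_val y).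
by rewrite -[mx_eval _ w]/(fld w y) -vw.
Qed.

Lemma inL_br v w : inL v -> inL w -> inL (br v w).
Proof.
move=> Lv Lw; case: Lsub => _ _ _; apply; [exact: Lv|exact: Lw|].
by apply: is_lie_bracket_field => //; exact: inL_tangent.
Qed.

Lemma inL_lin a v w : inL v -> inL w -> inL (mpolyC _ a *: v + w).
Proof.
move=> Lv Lw; case: Lsub => _ _ Llin _.
rewrite /inL (_ : fld _ = fun x => a *: fld v x + fld w x).
  exact: Llin.
apply/funext => x; apply/matrixP => i j.
by rewrite !mxE poly_evalD poly_evalM poly_evalC.
Qed.

Lemma inL0 : inL 0.
Proof.
case: Lsub => _ L0 _ _; rewrite /inL (_ : fld 0 = fun=> 0)//.
by apply/funext => x; apply/matrixP => i j; rewrite !mxE poly_eval0.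
Qed.

Lemma inLD v w : inL v -> inL w -> inL (v + w).
Proof. by move=> Lv Lw; have := inL_lin 1 Lv Lw; rewrite mpolyC1 scale1r. Qed.

Lemma inLZ a v : inL v -> inL (mpolyC _ a *: v).
Proof. by move=> Lv; have := inL_lin a Lv inL0; rewrite addr0. Qed.

Lemma inLN v : inL v -> inL (- v).
Proof. by move=> /(inLZ (-1)); rewrite mpolyCN mpolyC1 scaleN1r. Qed.

Lemma inLB v w : inL v -> inL w -> inL (v - w).
Proof. by move=> Lv Lw; apply: inLD => //; exact: inLN. Qed.

Lemma inL_lf_polys A : subspace (fun p : mp => inL (lf p A)).
Proof.
split=> [|a p q Lp Lq]; first by rewrite lf0l; exact: inL0.
by rewrite lfDl lfZl; exact: inL_lin.
Qed.

Lemma inL_lf_mx p : subspace (fun A => inL (lf p A)).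
Proof.
split=> [|a A C LA LC]; first by rewrite lf0r; exact: inL0.
by rewrite lfDr lfZr lfZl; exact: inL_lin.
Qed.

Definition multipliers p : Prop := forall A, form_lie B A -> inL (lf p A).

Lemma multipliers_subspace : subspace multipliers.
Proof.
split=> [A _|a p q Mp Mq A gA]; first exact: (inL_lf_polys A).1.
by apply: (inL_lf_polys A).2; [exact: Mp|exact: Mq].
Qed.

Hypothesis M1 : multipliers 1.

Lemma inL_DD p A C : form_lie B C -> inL (lf p A) ->
  inL (lf (DD C p) A + lf p (lie_br C A)).
Proof.
move=> gC Lp; have := inL_br (M1 gC) Lp.
by rewrite br_lf !mul1r DD1 mulr0 lf0l subr0.
Qed.

(** Bracketing [p A] with the constant field of [C] gives [(C p) A + p [C, A]], whose second term is
    already in [L]. *)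
Lemma multipliers_DD p C : form_lie B C -> multipliers p -> multipliers (DD C p).
Proof.
move=> gC Mp A gA; have := inL_DD gC (Mp _ gA) => LD.
by rewrite -[lf _ _](addrK (lf p (lie_br C A))); apply/inLB/Mp/form_lie_br.
Qed.

Lemma inL_star f h A C : multipliers f -> multipliers h ->
  form_lie B A -> form_lie B C ->
  inL (lf (f * DD A h) C - lf (h * DD C f) A + lf (f * h) (lie_br A C)).
Proof.
by move=> Mf Mh gA gC; rewrite -br_lf; apply/inL_br; [exact: Mf|exact: Mh].
Qed.

(* The seven brackets below are combined so that all terms with derivatives of
   [h] cancel, by the Jacobi identity. *)
Lemma inL_triple f h A A' C : multipliers f -> multipliers h ->
  form_lie B A -> form_lie B A' -> form_lie B C ->
  inL (lf (DD C (DD A f) * h) A' - lf (DD C (DD A' f) * h) A +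
       lf (DD C f * h) (lie_br A A')).
Proof.
move=> Mf Mh gA gA' gC.
have MA := multipliers_DD gA Mh; have MA' := multipliers_DD gA' Mh.
have MC := multipliers_DD gC Mf.
have i1 := inL_star Mf MA' gA gC; have i2 := inL_star Mf Mh gA (form_lie_br gA' gC).
have j1 := inL_star Mf MA gA' gC; have j2 := inL_star Mf Mh gA' (form_lie_br gA gC).
have i3 := inL_star Mf Mh (form_lie_br gA gA') gC.
have i4 := inL_star MC Mh gA' gA; have i5 := inL_star MC Mh gA gA'.
have := inLN (inLB (inLD (inLB (inLB (inLB (inLD i1 i2) j1) j2) i3) i4) i5).
congr (inL _).
have brN : lie_br A' A = - lie_br A A' by rewrite /lie_br opprB.
have jac : lie_br (lie_br A A') C =
    lie_br A (lie_br A' C) - lie_br A' (lie_br A C).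
  rewrite /lie_br !(mulmxBl, mulmxBr) !mulmxA.
  by apply/matrixP => i j; rewrite !mxE; ring.
rewrite brN jac !DD_br {brN jac i1 i2 j1 j2 i3 i4 i5}.
move: (lie_br A (lie_br A' C)) (lie_br A' (lie_br A C)) => e1 e2.
move: (lie_br A A') (lie_br A C) (lie_br A' C) => eAA' eAC eA'C.
have -> : lf (f * h) (e1 - e2) = (f * h) *: (X *m cst_mx e1 - X *m cst_mx e2).
  by rewrite /lf cst_mxB mulmxBr.
have -> : lf (DD C f * h) (- eAA') = (DD C f * h) *: - (X *m cst_mx eAA').
  by rewrite /lf -[- eAA']sub0r cst_mxB cst_mx0 sub0r mulmxN.
exact: triple_identity.
Qed.

End Subalgebra.
End LinearFields.

(** * Generation and completeness *)

(* [H := conj_diag P l] is a diagonalizable element with simple spectrum, [N] and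
   [E] are nilpotent; the last fields say that [N] and [ad H] generate the Lie
   algebra, that the ideal generated by [E] is everything, and give spanning
   sets and a projector. *)
Record generators (K : numFieldType) (d : nat) (B P : 'M[K]_d) (l : 'I_d -> K)
    (N E : 'M[K]_d) (a : K) : Prop := Generators {
  gen_unit : P \in unitmx;
  gen_inj : injective l;
  gen_H : form_lie B (conj_diag P l);
  gen_N : form_lie B N;
  gen_N3 : N *m N *m N = 0;
  gen_E : form_lie B E;
  gen_E2 : E *m E = 0;
  gen_HE : lie_br (conj_diag P l) E = a *: E;
  gen_Lie : forall S : set 'M[K]_d, subspace S ->
    (forall A C, S A -> S C -> S (lie_br A C)) ->
    (forall A, S A -> S (lie_br (conj_diag P l) A)) -> S N ->
    form_lie B `<=` S;
  gen_ideal : forall S : set 'M[K]_d, subspace S ->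
    (forall A C, form_lie B A -> S C -> S (lie_br A C)) -> S E ->
    form_lie B `<=` S;
  gen_vectors : forall S : set 'cV[K]_d, subspace S ->
    (forall A k, form_lie B A -> E *m col k P = 0 -> l k + a != 0 ->
      S (A *m col k P)) -> forall v, S v;
  gen_nilpotent : forall S : set 'M[K]_d, subspace S ->
    (forall A, form_lie B A -> A *m A *m A = 0 -> S A) -> form_lie B `<=` S;
  gen_projector : exists pr : 'I_d -> 'I_d -> 'M[K]_d,
    (forall i j, form_lie B (pr i j)) /\
    (forall A, form_lie B A -> A = \sum_i \sum_j A i j *: pr i j)
}.

Lemma conj_diagM (K : numFieldType) d (P : 'M[K]_d) l l' : P \in unitmx ->
  conj_diag P l *m conj_diag P l' = conj_diag P (fun k => l k * l' k).
Proof.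
move=> Pu; rewrite /conj_diag !mulmxA mulmxKV//; congr (_ *m _).
rewrite -!mulmxA; congr (_ *m _); apply/matrixP => i j.
rewrite mulmx_diagE !mxE; case: eqVneq => [->|_]; first by rewrite !mulr1n.
by rewrite !mulr0n mulr0.
Qed.

Lemma conj_diag_comm (K : numFieldType) d (P : 'M[K]_d) l l' : P \in unitmx ->
  conj_diag P l *m conj_diag P l' = conj_diag P l' *m conj_diag P l.
Proof.
move=> Pu; rewrite !conj_diagM//; congr (conj_diag P _).
by apply/funext => k; rewrite mulrC.
Qed.

Lemma exists_nat_notin (K : numDomainType) (s : seq K) :
  exists n : nat, n%:R \notin s.
Proof.
apply: contrapT => h.
have sub : {subset [seq n%:R | n <- iota 0 (size s).+1] <= s}.
  move=> _ /mapP[n _ ->]; apply: contrapT => /negP ns; apply: h; by exists n.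
have un : uniq [seq (n%:R : K) | n <- iota 0 (size s).+1].
  by rewrite map_inj_uniq ?iota_uniq//; exact: mulrIn (oner_neq0 _).
by have := uniq_leq_size un sub; rewrite size_map size_iota ltnn.
Qed.

Lemma exists_separating (K : numFieldType) (d : nat) (l : 'I_d -> K) :
  injective l ->
  exists c : K, injective (fun ij : 'I_d * 'I_d => c * l ij.1 + l ij.2).
Proof.
move=> linj.
(* A collision of two values with [i != i'] forces [c] to be one of these finitely many ratios. *)
have [n ns] := exists_nat_notin [seq (l q.2.2 - l q.1.2) / (l q.1.1 - l q.2.1)
  | q <- enum {: ('I_d * 'I_d) * ('I_d * 'I_d)}].
exists n%:R => -[i j] [i' j'] /= e.
have [ii|ii] := eqVneq i i'.
  by move: e; rewrite ii => /addrI /linj ->.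
case/negP: ns; apply/mapP; exists ((i, j), (i', j')); first by rewrite mem_enum.
rewrite /=; have li : l i - l i' != 0 by rewrite subr_eq0 (inj_eq linj).
apply: (mulIf li); rewrite divfK//.
have -> : n%:R * (l i - l i') = n%:R * l i + l j - n%:R * l i' - l j by ring.
by rewrite e; ring.
Qed.

Lemma conj_identity (R : comNzRingType) n (Q P H D Y : 'M[R]_n) (c : R) :
  Q *m H = D *m Q -> H *m P = P *m D ->
  Q *m (c *: H *m Y + Y *m H) *m P = c *: (D *m (Q *m Y *m P)) + Q *m Y *m P *m D.
Proof.
move=> QH HP; rewrite mulmxDr mulmxDl -scalemxAl -scalemxAr -scalemxAl.
by rewrite !mulmxA QH -!mulmxA HP !mulmxA.
Qed.

Lemma weight_identity (K : numFieldType) d (l : 'I_d -> K) (c : K)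
    (Y : 'M[mpoly (d * d) K]_d) i j :
  (mpolyC _ c *: (cst_mx d (diag_mx (\row_k l k)) *m Y) +
   Y *m cst_mx d (diag_mx (\row_k l k))) i j = (c * l i + l j) *: Y i j.
Proof.
rewrite /cst_mx map_diag_mx mxDE mxE mul_diag_mx mul_mx_diag 4!mxE [in RHS]scalerDl.
rewrite -!mul_mpolyC mpolyCM mulrA [X in _ + X]mulrC; congr (_ + _ * _).
by rewrite !mxE.
Qed.

(** * Any subalgebra containing the three fields contains all polynomial fields *)

Section Generation.
Variables (K : numFieldType) (d : nat) (B : 'M[K]_d).
Local Notation G := (form_group B).
Local Notation mp := (mpoly (d * d) K).
Local Notation X := (entry_mx K d).
Local Notation fld := (@field_of K d B).
Local Notation cmx := (cst_mx d).
Hypothesis lieG : forall A, lie_algebra G A <-> form_lie B A.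
Variables (P : 'M[K]_d) (l : 'I_d -> K) (N E : 'M[K]_d) (a c : K).
Hypothesis gens : generators B P l N E a.
Hypothesis sep : injective (fun ij : 'I_d * 'I_d => c * l ij.1 + l ij.2).
Let H := conj_diag P l.

(** The coordinates of [x] in the eigenbasis of [H]: weight vectors for left and right
    multiplication by [H] at once. Their sum is the coefficient of the third field, so that every
    weight occurs in it. *)
Definition weight_mx : 'M[mp]_d := cmx (invmx P) *m X *m cmx P.
Definition weight_sum : mp := \sum_(ij : 'I_d * 'I_d) weight_mx ij.1 ij.2.

Local Notation v1 := (bi_field (c *: H) H).
Local Notation v2 := (lf 1 N).
Local Notation v3 := (lf weight_sum E).

Variable (L : set (matrix_field G)).
Hypothesis Lsub : lie_subalgebra L.
Hypothesis L1 : L (fld v1).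
Hypothesis L2 : L (fld v2).
Hypothesis L3 : L (fld v3).
Local Notation inL := (inL L).
Local Notation mult := (multipliers L).

(** The field of [H] itself is not yet known to lie in [L], but bracketing with the first field acts
    as [ad H] on constants. This is why [gen_Lie] asks for stability under [ad H] and not for [H] in
    [S]. *)
Lemma multipliers1 : mult 1.
Proof.
move=> A gA.
have Sbr C D : inL (lf 1 C) -> inL (lf 1 D) -> inL (lf 1 (lie_br C D)).
  move=> LC LD; have := inL_br lieG Lsub LC LD.
  by rewrite br_lf !DD1 !mulr0 !lf0l subrr add0r mulr1.
have SH C : inL (lf 1 C) -> inL (lf 1 (lie_br H C)).
  move=> LC; have := inL_br lieG Lsub L1 LC.
  by rewrite br_bi_lf -(mpolyC1 (d * d) K) derC lf0l add0r.
exact: (gen_Lie gens (inL_lf_mx Lsub 1) Sbr SH L2 gA).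
Qed.

Lemma der_weight i j :
  der v1 (weight_mx i j) = (c * l i + l j) *: weight_mx i j.
Proof.
rewrite /weight_mx der_mx /bi_field cst_mxZ.
rewrite (conj_identity X (mpolyC _ c) (D := cmx (diag_mx (\row_k l k)))).
- by rewrite -/weight_mx; exact: weight_identity.
- rewrite -!cst_mxM; congr (cmx _); rewrite /H /conj_diag !mulmxA mulVmx ?mul1mx//.
  exact: gen_unit gens.
- rewrite -!cst_mxM; congr (cmx _); rewrite /H /conj_diag mulmxKV//.
  exact: gen_unit gens.
Qed.

(** Bracketing [p E] with the first field gives [T p] times [E]. Since [[H, E] = a E], all
    eigenvalues are shifted by the same [a] and stay distinct. *)
Lemma inL_weight i j : inL (lf (weight_mx i j) E).
Proof.
have Ssub := inL_lf_polys Lsub E.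
pose T (p : mp) := der v1 p + a *: p.
have ST p : inL (lf p E) -> inL (lf (T p) E).
  move=> Lp; have := inL_br lieG Lsub L1 Lp.
  by rewrite br_bi_lf (gen_HE gens) lfZr -lfDl.
have Tlin (b : 'I_d * 'I_d -> K) :
    T (\sum_ij b ij *: weight_mx ij.1 ij.2) =
    \sum_ij (b ij * (c * l ij.1 + l ij.2 + a)) *: weight_mx ij.1 ij.2.
  rewrite /T der_sum scaler_sumr -big_split/=; apply: eq_bigr => ij _.
  rewrite derZ der_weight !scalerA -scalerDl; congr (_ *: _); ring.
have := subspace_eigen Ssub ST Tlin L3 (i, j).
rewrite (eq_bigl (pred1 (i, j))) ?big_pred1_eq// => ij /=.
by rewrite (inj_eq (addIr a)); exact: (inj_eq sep ij (i, j)).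
Qed.

Lemma inL_entry i j : inL (lf (X i j) E).
Proof.
have Ssub := inL_lf_polys Lsub E; have Pu := gen_unit gens.
have -> : X i j = \sum_k \sum_m (P i m * (invmx P) k j) *: weight_mx m k.
  have {1}-> : X = cmx P *m weight_mx *m cmx (invmx P).
    rewrite /weight_mx !mulmxA -cst_mxM mulmxV// cst_mx1 mul1mx -mulmxA.
    by rewrite -cst_mxM mulmxV// cst_mx1 mulmx1.
  rewrite mxE; apply: eq_bigr => k _; rewrite mxE mulr_suml.
  apply: eq_bigr => m _; rewrite [cmx P _ _]mxE [cmx (invmx P) _ _]mxE.
  by rewrite -mul_mpolyC mpolyCM mulrAC.
apply: (subspace_sum Ssub) => k _; apply: (subspace_sum Ssub) => m _.
exact/(subspaceZ Ssub)/inL_weight.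
Qed.

Lemma DD_entry A i j : DD A (X i j) = \sum_k A k j *: X i k.
Proof.
rewrite /DD [X i j in LHS]mxE der_var mxE; apply: eq_bigr => k _.
by rewrite [cmx A _ _]mxE mulrC mul_mpolyC.
Qed.

(* Bracketing with constant fields moves the coefficient matrix through the ideal
   generated by [E]. *)
Lemma inL_ideal (M' : set mp) :
  (forall h C, form_lie B C -> M' h -> M' (DD C h)) ->
  (forall h i j, M' h -> inL (lf (X i j * h) E)) ->
  forall h i j, M' h -> mult (X i j * h).
Proof.
move=> MD ME h i j Mh A gA.
(* Quantifying over all [h], [i], [j] makes [S] stable: differentiating [x_ij h] produces other
   entries times [h], and [x_ij] times a derivative of [h], which [M'] contains. *)
pose S := [set A | forall h i j, M' h -> inL (lf (X i j * h) A)].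
have Ssub : subspace S.
  split=> [p k m Mp|b C D LC LD p k m Mp]; first exact: (inL_lf_mx Lsub _).1.
  by apply: (inL_lf_mx Lsub _).2; [exact: LC|exact: LD].
have SE : S E by move=> p k m Mp; exact: ME.
have Sbr C D : form_lie B C -> S D -> S (lie_br C D).
  move=> gC LD p k m Mp.
  have := inL_DD lieG Lsub multipliers1 gC (LD p k m Mp).
  set q := X k m * p => Lq.
  have Lq' : inL (lf (DD C q) D).
    rewrite /q /DD derM -/(DD C _) -/(DD C p) DD_entry mulr_suml.
    have Dsub := inL_lf_polys Lsub D.
    apply: (subspaceD Dsub); last by apply: LD; exact: MD.
    apply: (subspace_sum Dsub) => k' _; rewrite -scalerAl.
    by apply: (subspaceZ Dsub); exact: LD.
  by rewrite -[lf q _](addKr (lf (DD C q) D)) addrC; exact: (inLB Lsub Lq Lq').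
have SA : S A := gen_ideal gens Ssub Sbr SE gA.
exact: (SA h i j Mh).
Qed.

Lemma multipliers_entry i j : mult (X i j).
Proof.
rewrite -[X i j]mulr1.
apply: (inL_ideal (M' := [set h | exists b, h = mpolyC _ b])); last by exists 1.
  by move=> h C _ [b ->]; exists 0; rewrite /DD derC mpolyC0.
move=> h k m [b ->]; rewrite mulrC mul_mpolyC.
exact: (subspaceZ (inL_lf_polys Lsub E) _ (inL_entry k m)).
Qed.

(** Here [f] is the linear function [(x p_k)_i], with [p_k] the [k]-th column of [P]; deriving it
    along [A] replaces [p_k] by [A p_k]. In [inL_triple] the eigenvalue [l k] of [H] on [f] and the
    [a] from [[H, E]] add up, hence the condition [l k + a != 0]. *)
Lemma inL_vector h k A i : mult h -> form_lie B A -> E *m col k P = 0 ->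
  l k + a != 0 -> inL (lf ((X *m cmx (A *m col k P)) i 0 * h) E).
Proof.
move=> Mh gA Ek lk.
pose f := (X *m cmx (col k P)) i 0.
have Df C : DD C f = (X *m cmx (C *m col k P)) i 0.
  by rewrite /DD der_mulr -mulmxA -cst_mxM.
have Mf : mult f.
  rewrite /f mxE; apply: (subspace_sum (multipliers_subspace Lsub)) => j _.
  rewrite [cmx _ _ _]mxE mulrC mul_mpolyC.
  exact: (subspaceZ (multipliers_subspace Lsub) _ (multipliers_entry i j)).
have Hk : H *m col k P = l k *: col k P.
  rewrite [in LHS]colE mulmxA -colE; apply/colP => m.
  rewrite /H /conj_diag mulmxKV ?(gen_unit gens)//.
  by rewrite [LHS]mxE mulmx_diagEr [RHS]mxE [X in _ = _ * X]mxE mulrC.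
have DHf : DD H f = l k *: f.
  rewrite Df Hk cst_mxZ -scalemxAr mxE mul_mpolyC; congr (_ *: _).
have DEf : DD E f = 0 by rewrite Df Ek cst_mx0 mulmx0 mxE.
have := inL_triple lieG Lsub multipliers1 Mf Mh (gen_H gens) (gen_E gens) gA.
rewrite -/H DHf DEf {2}/DD der0 mul0r lf0l subr0 (gen_HE gens) lfZr -lfDl.
have -> : DD A (l k *: f) * h + a *: (DD A f * h) = (l k + a) *: (DD A f * h).
  by rewrite /DD derZ -scalerAl -scalerDl.
by move=> /(subspaceZK (inL_lf_polys Lsub E) lk); rewrite Df.
Qed.

(** By [gen_vectors] the vectors reached in [inL_vector] span, so every [x_ij h E] is in [L];
    [inL_ideal] then replaces [E] by any element of the Lie algebra. *)
Lemma multipliers_entryM h i j : mult h -> mult (X i j * h).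
Proof.
apply: (inL_ideal (M' := mult)) => [p C gC Mp|{}h {}i {}j Mh].
  exact: (multipliers_DD lieG Lsub multipliers1).
pose S := [set v : 'cV[K]_d | forall h i, mult h ->
  inL (lf ((X *m cmx v) i 0 * h) E)].
have Ssub : subspace S.
  split=> [p k _|b u v Lu Lv p k Mp].
    by rewrite cst_mx0 mulmx0 mxE mul0r lf0l; exact: inL0.
  rewrite cst_mxD cst_mxZ mulmxDr -scalemxAr mxDE [X in X + _]mxE mul_mpolyC.
  rewrite mulrDl -scalerAl.
  by apply: (inL_lf_polys Lsub E).2; [exact: Lu|exact: Lv].
have SA A k : form_lie B A -> E *m col k P = 0 -> l k + a != 0 ->
    S (A *m col k P).
  by move=> gA Ek lk p m Mp; exact: inL_vector.
have Sall v : S v := gen_vectors gens Ssub SA v.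
have -> : X i j = (X *m cmx (delta_mx j 0 : 'cV[K]_d)) i 0.
  rewrite [RHS]mxE (bigD1 j)//= big1 ?addr0 => [|k kj].
    by rewrite [cmx _ _ _]mxE [delta_mx _ _ _ _]mxE !eqxx mpolyC1 mulr1.
  by rewrite [cmx _ _ _]mxE [delta_mx _ _ _ _]mxE (negPf kj) mpolyC0 mulr0.
exact: (Sall (delta_mx j 0) h i Mh).
Qed.

Lemma multipliers_all p : mult p.
Proof.
(* Strengthened to [p * h] for every multiplier [h], so that the product case is a composition. *)
rewrite -[p]mulr1; move: multipliers1.
move: (1 : mp); elim/entry_poly_ind: p => [b|i j|p q Hp Hq|p q Hp Hq] h Mh.
- by rewrite mul_mpolyC; exact: (subspaceZ (multipliers_subspace Lsub) _ Mh).
- by have := multipliers_entryM i j Mh; rewrite mxE.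
- by rewrite mulrDl; apply: (subspaceD (multipliers_subspace Lsub)); auto.
- by rewrite -mulrA; auto.
Qed.

(** As [det x = 1] on [G], the adjugate makes [x^-1 v] polynomial. Its values are in the Lie algebra
    only at points of [G], so the projector is used to rewrite it there with polynomial coefficients
    on elements of the Lie algebra. *)
Lemma X_alg_subset : X_alg G `<=` L.
Proof.
move=> _ /(X_algP lieG) [v tv ->].
have [pr [gpr prE]] := gen_projector gens.
pose A : 'M[mp]_d := \adj X *m v.
have AE x : G x -> mx_eval x A = invmx x *m mx_eval x v.
  move=> Gx; rewrite mx_evalM /invmx unitmxE (proj1 Gx) unitr1 invr1 scale1r.
  congr (_ *m _); rewrite -[x in RHS](mx_eval_entry x).
  exact: (map_mx_adj (meval _)).
rewrite (_ : fld v = fld (\sum_i \sum_j lf (A i j) (pr i j))).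
  rewrite -/(inL _); elim/big_ind: _ => [|u w|i _].
  - exact: inL0.
  - exact: inLD.
  - elim/big_ind: _ => [|u w|j _]; [exact: inL0|exact: inLD|].
    exact: multipliers_all.
apply/funext => x; have Gx := G_val x; rewrite /field_of.
rewrite -[LHS](mulKVmx (form_group_unit Gx)).
rewrite [X in _ *m X](prE _ (tv _ Gx)) -AE//.
have mx_eval_sum (F : 'I_d -> 'M[mp]_d) :
    mx_eval (val x) (\sum_i F i) = \sum_i mx_eval (val x) (F i).
  have ev0 : mx_eval (val x) (0 : 'M[mp]_d) = 0.
    by apply/matrixP => i j; rewrite !mxE poly_eval0.
  exact: (big_morph _ (fun u w => mx_evalD u w (val x)) ev0).
rewrite mulmx_sumr mx_eval_sum; apply: eq_bigr => i _.
rewrite mulmx_sumr mx_eval_sum; apply: eq_bigr => j _.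
by rewrite mx_eval_lf -scalemxAr mxE.
Qed.

End Generation.

(** * Explicit flows of the three fields *)

Section Completeness.
Variables (K : numFieldType) (d : nat) (B : 'M[K]_d) (ex : K -> K).
Local Notation G := (form_group B).
Local Notation mp := (mpoly (d * d) K).
Local Notation fld := (@field_of K d B).
Hypothesis hex : is_exponential ex.
Variables (P : 'M[K]_d) (l : 'I_d -> K) (N E : 'M[K]_d) (a : K).
Hypothesis gens : generators B P l N E a.

Lemma C_complete_field (v : 'M[mp]_d) (phi : K -> 'M[K]_d -> 'M[K]_d) :
  (forall t x, G x -> G (phi t x)) -> (forall x, phi 0 x = x) ->
  (forall t x, G x -> has_derivative (phi^~ x) t (mx_eval (phi t x) v)) ->
  C_complete (fld v).
Proof.
move=> phiG phi0 dphi.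
exists (fun t (x : G) => exist _ (phi t (val x)) (mem_set (phiG t _ (G_val x)))).
move=> x; split; first by apply: val_inj; exact: phi0.
by move=> t; exact: dphi (G_val x).
Qed.

Lemma conj_diagZ c : conj_diag P (fun k => c * l k) = c *: conj_diag P l.
Proof.
rewrite /conj_diag scalemxAl scalemxAr; congr (_ *m _ *m _).
by apply/matrixP => i j; rewrite !mxE mulrnAr.
Qed.

Lemma C_complete_diag c :
  C_complete (fld (bi_field (c *: conj_diag P l) (conj_diag P l))).
Proof.
have Pu := gen_unit gens.
pose u t := conj_diag P (fun k => ex (c * l k * t)).
pose w t := conj_diag P (fun k => ex (l k * t)).
have cH : form_lie B (conj_diag P (fun k => c * l k)).
  by rewrite conj_diagZ; exact: (subspaceZ (form_lie_subspace B) _ (gen_H gens)).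
apply: (C_complete_field (phi := fun t x => u t *m x *m w t)).
- move=> t x Gx; apply: form_groupM; first apply: form_groupM => //.
    exact: conj_diag_form_group.
  exact/conj_diag_form_group/(gen_H gens).
- have one m : conj_diag P (fun k => ex (m k * 0)) = 1%:M.
    rewrite /conj_diag (_ : diag_mx _ = 1%:M) ?mulmx1 ?mulmxV//.
    by apply/matrixP => i j; rewrite !mxE mulr0 (exponential0 hex).
  by move=> x; rewrite /u /w !one mul1mx mulmx1.
- move=> t x Gx; rewrite mx_eval_bi -conj_diagZ.
  have du := has_derivative_conj_diag (fun k => c * l k) t hex Pu.
  have dw := has_derivative_conj_diag l t hex Pu.
  have := has_derivative_mul (has_derivative_mulr x du) dw.
  by rewrite -/(u t) -/(w t) (conj_diag_comm _ _ Pu) !mulmxA.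
Qed.

Lemma C_complete_nilpotent : C_complete (fld (lf 1 N)).
Proof.
apply: (C_complete_field (phi := fun t x => x *m exp3 N t)).
- move=> t x Gx; apply: form_groupM => //.
  by apply: exp3_form_group; [exact: gen_N gens|exact: gen_N3 gens].
- by move=> x; rewrite exp3_0 mulmx1.
- move=> t x Gx; rewrite mx_eval_lf poly_eval1 scale1r -mulmxA.
  exact/has_derivative_mull/has_derivative_exp3/(gen_N3 gens).
Qed.

(* Along the flow of [f x E] with [f] linear and [E^2 = 0], one has
   [x_t = x (1 + tau E)] with [tau' = f x + tau f (x E)], a scalar linear
   equation. *)
Lemma C_complete_overshear : C_complete (fld (lf (weight_sum P) E)).
Proof.
pose f (x : 'M[K]_d) : K := \sum_(ij : 'I_d * 'I_d) (invmx P *m x *m P) ij.1 ij.2.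
have fE x : poly_eval (weight_sum P) x = f x.
  rewrite /weight_sum poly_eval_sum; apply: eq_bigr => ij _.
  have -> : invmx P *m x *m P = mx_eval x (weight_mx P).
    by rewrite /weight_mx !mx_evalM mx_eval_entry !mx_evalC.
  by rewrite [RHS]mxE.
have flin b x y : f (b *: x + y) = b * f x + f y.
  rewrite /f mulr_sumr -big_split/=; apply: eq_bigr => ij _.
  by rewrite mulmxDr mulmxDl -scalemxAr -scalemxAl !mxE.
(* [g c] is the solution of [g' = 1 + c g] with [g 0 = 0], including the degenerate case [c = 0]. *)
pose g c t := if c == 0 then t else (ex (c * t) - 1) / c.
have g0 c : g c 0 = 0.
  by rewrite /g; case: eqP => //; rewrite mulr0 (exponential0 hex) subrr mul0r.
have gE c t : 1 + c * g c t = ex (c * t).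
  rewrite /g; case: eqVneq => [->|c0].
    by rewrite !mul0r addr0 (exponential0 hex).
  by rewrite mulrC divfK// addrC subrK.
have dg c t : is_derive t (1 : K) (g c) (ex (c * t)).
  have [->|c0] := eqVneq c 0.
    rewrite mul0r (exponential0 hex) (_ : g 0 = id); first exact: is_derive_id.
    by apply/funext => s; rewrite /g eqxx.
  rewrite (_ : g c = fun s => c^-1 * (ex (c * s) + -1)); last first.
    by apply/funext => s; rewrite /g (negPf c0) mulrC.
  have := is_derive_scale c^-1 (is_derive_add
    (is_derive_exponentialZ c t hex) (is_derive_const t (-1))).
  by rewrite addr0 mulKf.
pose tau x t := f x * g (f (x *m E)) t.
apply: (C_complete_field (phi := fun t x => x *m (1%:M + tau x t *: E))).
- move=> t x Gx; apply: form_groupM => //.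
  have -> : 1%:M + tau x t *: E = exp3 E (tau x t).
    by rewrite /exp3 (gen_E2 gens) scaler0 addr0.
  apply: exp3_form_group; first exact: gen_E gens.
  by rewrite (gen_E2 gens) mul0mx.
- by move=> x; rewrite /tau g0 mulr0 scale0r addr0 mulmx1.
- move=> t x Gx; rewrite mx_eval_lf fE.
  have -> : f (x *m (1%:M + tau x t *: E)) = f x * ex (f (x *m E) * t).
    by rewrite mulmxDr mulmx1 -scalemxAr addrC flin -gE /tau; ring.
  rewrite -mulmxA mulmxDl mul1mx -scalemxAl (gen_E2 gens) scaler0 addr0 scalemxAr.
  apply: has_derivative_mull; rewrite -[_ *: E]add0r.
  apply: has_derivative_add; first exact: has_derivative_cst.
  by apply: has_derivative_scale; apply: is_derive_scale; exact: dg.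
Qed.

Theorem form_group_generators : exists W1 W2 W3 : matrix_field G,
  [/\ X_alg G W1 /\ C_complete W1, X_alg G W2 /\ C_complete W2,
      X_alg G W3 /\ C_complete W3 & X_alg G = lie_generated [set W1; W2; W3]].
Proof.
have lieG A : lie_algebra G A <-> form_lie B A.
  split=> [|gA]; first exact: lie_algebra_form.
  apply: (gen_nilpotent gens (lie_algebra_subspace B)) gA => C gC C3.
  exact: lie_algebra_nilpotent.
have [c sep] := exists_separating (gen_inj gens).
have cH : form_lie B (c *: conj_diag P l).
  exact: (subspaceZ (form_lie_subspace B) _ (gen_H gens)).
have X1 : X_alg G (fld (bi_field (c *: conj_diag P l) (conj_diag P l))).
  apply/(X_algP lieG); eexists; last by [].
  exact: (tangent_bi lieG cH (gen_H gens)).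
have X2 : X_alg G (fld (lf 1 N)).
  apply/(X_algP lieG); eexists; last by [].
  exact: (tangent_lf _ (gen_N gens)).
have X3 : X_alg G (fld (lf (weight_sum P) E)).
  apply/(X_algP lieG); eexists; last by [].
  exact: (tangent_lf _ (gen_E gens)).
exists (fld (bi_field (c *: conj_diag P l) (conj_diag P l))).
exists (fld (lf 1 N)), (fld (lf (weight_sum P) E)).
split.
- by split=> //; exact: C_complete_diag.
- by split=> //; exact: C_complete_nilpotent.
- by split=> //; exact: C_complete_overshear.
rewrite eqEsubset; split.
- move=> V XV L [Lsub SL].
  have L1 : L (fld (bi_field (c *: conj_diag P l) (conj_diag P l))).
    by apply: SL; left; left.
  have L2 : L (fld (lf 1 N)) by apply: SL; left; right.
  have L3 : L (fld (lf (weight_sum P) E)) by apply: SL; right.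
  exact: (X_alg_subset lieG gens sep Lsub L1 L2 L3 XV).
- apply: bigcap_inf; split; first exact: X_alg_lie_subalgebra.
  by move=> _ [[->|->]|->].
Qed.

End Completeness.

(** * Orthogonal and symplectic Lie algebras *)

Lemma lie_br_linear (K : numFieldType) d (H : 'M[K]_d) (I : finType)
    (v : I -> 'M[K]_d) (lam : I -> K) :
  (forall i, lie_br H (v i) = lam i *: v i) ->
  forall c : I -> K,
    lie_br H (\sum_i c i *: v i) = \sum_i (c i * lam i) *: v i.
Proof.
move=> Hv c; rewrite /lie_br mulmx_sumr mulmx_suml -sumrB.
apply: eq_bigr => i _.
by rewrite -scalemxAl -scalemxAr -scalerBr -/(lie_br _ _) Hv scalerA.
Qed.

Definition bf (K : numFieldType) d (B : 'M[K]_d) (u v : 'cV[K]_d) : K :=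
  (u^T *m B *m v) 0 0.

(* The columns of [P] are weight vectors with integer weights [z], and [s k] is
   the index of the weight vector dual to the [k]-th one. *)
Record weight_basis (K : numFieldType) d (B P : 'M[K]_d) (s : 'I_d -> 'I_d)
    (z : 'I_d -> int) (jj : 'I_d -> K) (o : 'I_d) : Prop := WeightBasis {
  wb_unit : P \in unitmx;
  wb_involutive : involutive s;
  wb_form : forall k m,
    bf B (col k P) (col m P) = if m == s k then jj k else 0;
  wb_nz : forall k, jj k != 0;
  wb_inj : injective z;
  wb_opp : forall k, z (s k) = - z k;
  wb_pos : 0 < z o;
  wb_max : forall k, z k <= z o
}.

Section Bilinear.
Variables (K : numFieldType) (d : nat) (B : 'M[K]_d) (e : K).
Hypothesis Be : B^T = e *: B.
Hypothesis e2 : e * e = 1.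
Hypothesis Bu : B \in unitmx.
Implicit Types (u v w : 'cV[K]_d) (A C : 'M[K]_d).

Local Notation bf := (bf B).

(** The map sending [w] to [B(v, w) u - e B(u, w) v]: the exterior square model of the orthogonal
    algebra for [e = 1], the symmetric square model of the symplectic one for [e = -1]. *)
Definition wedge u v : 'M[K]_d := u *m (v^T *m B) - e *: (v *m (u^T *m B)).

Lemma bfE u v : u^T *m B *m v = (bf u v)%:M.
Proof. exact: mx11_scalar. Qed.

Lemma bf_sym u v : bf v u = e * bf u v.
Proof.
rewrite /bf -[in LHS](trmxK (v^T *m B *m u)) [LHS]mxE !trmx_mul trmxK Be.
by rewrite -scalemxAl -scalemxAr mxE mulmxA.
Qed.

Lemma bfDl u v w : bf (u + v) w = bf u w + bf v w.
Proof. by rewrite /bf linearD/= !mulmxDl mxE. Qed.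

Lemma bfDr u v w : bf w (u + v) = bf w u + bf w v.
Proof. by rewrite /bf mulmxDr mxE. Qed.

Lemma bfZl c u v : bf (c *: u) v = c * bf u v.
Proof. by rewrite /bf linearZ/= -!scalemxAl mxE. Qed.

Lemma bfZr c u v : bf u (c *: v) = c * bf u v.
Proof. by rewrite /bf -scalemxAr mxE. Qed.

Lemma bf_sumr (I : finType) (P : pred I) (F : I -> 'cV[K]_d) u :
  bf u (\sum_(i | P i) F i) = \sum_(i | P i) bf u (F i).
Proof. by rewrite /bf mulmx_sumr summxE. Qed.

Lemma bf_suml (I : finType) (P : pred I) (F : I -> 'cV[K]_d) u :
  bf (\sum_(i | P i) F i) u = \sum_(i | P i) bf (F i) u.
Proof. by rewrite /bf linear_sum/= !mulmx_suml summxE. Qed.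

Lemma wedge_mul u v w : wedge u v *m w = bf v w *: u - (e * bf u w) *: v.
Proof.
rewrite /wedge mulmxBl -scalemxAl -!mulmxA (mulmxA _ B) (mulmxA u^T B) !bfE.
by rewrite !mul_mx_scalar scalerA.
Qed.

Lemma mul_wedge A u v : A *m wedge u v =
  (A *m u) *m (v^T *m B) - e *: ((A *m v) *m (u^T *m B)).
Proof. by rewrite /wedge mulmxBr -scalemxAr !mulmxA. Qed.

Lemma wedgeDl u v w : wedge (u + v) w = wedge u w + wedge v w.
Proof.
by rewrite /wedge linearD/= !mulmxDl mulmxDr scalerDr opprD addrACA.
Qed.

Lemma wedgeDr u v w : wedge w (u + v) = wedge w u + wedge w v.
Proof.
by rewrite /wedge linearD/= !mulmxDl mulmxDr scalerDr opprD addrACA.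
Qed.

Lemma wedgeZl c u v : wedge (c *: u) v = c *: wedge u v.
Proof.
rewrite /wedge [(c *: u)^T]linearZ/= -!scalemxAl -!scalemxAr scalerBr !scalerA.
by rewrite (mulrC e).
Qed.

Lemma wedgeZr c u v : wedge u (c *: v) = c *: wedge u v.
Proof.
rewrite /wedge [(c *: v)^T]linearZ/= -!scalemxAl -!scalemxAr scalerBr !scalerA.
by rewrite (mulrC e).
Qed.

Lemma wedge0l v : wedge 0 v = 0.
Proof. by rewrite -(scale0r v) wedgeZl scale0r. Qed.

Lemma wedge0r v : wedge v 0 = 0.
Proof. by rewrite -(scale0r v) wedgeZr scale0r. Qed.

Lemma wedge_suml (I : finType) (P : pred I) (F : I -> 'cV[K]_d) v :
  wedge (\sum_(i | P i) F i) v = \sum_(i | P i) wedge (F i) v.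
Proof.
by apply: (big_morph (wedge^~ v)); [move=> u w; exact: wedgeDl|exact: wedge0l].
Qed.

Lemma wedge_sumr (I : finType) (P : pred I) (F : I -> 'cV[K]_d) v :
  wedge v (\sum_(i | P i) F i) = \sum_(i | P i) wedge v (F i).
Proof.
by apply: (big_morph (wedge v)); [move=> u w; exact: wedgeDr|exact: wedge0r].
Qed.

Lemma wedgeC u v : wedge v u = - e *: wedge u v.
Proof. by rewrite /wedge scalerBr !scaleNr scalerA e2 scale1r opprK addrC. Qed.

Lemma wedge_id u : e = 1 -> wedge u u = 0.
Proof. by move=> e1; rewrite /wedge e1 scale1r subrr. Qed.

Lemma form_lie_wedge u v : form_lie B (wedge u v).
Proof.
split.
  rewrite /wedge linearB linearZ/= !(mxtrace_mulC _ (_ *m B)) !bfE.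
  by rewrite !mxtrace_scalar !mulr1n (bf_sym u v) subrr.
pose M := u *m v^T - e *: (v *m u^T).
have -> : wedge u v = M *m B by rewrite /M mulmxBl -scalemxAl -!mulmxA.
have MT : M^T = - (e *: M).
  rewrite /M [LHS]linearB/= [X in _ - X]linearZ/= !trmx_mul !trmxK.
  by rewrite scalerBr scalerA e2 scale1r opprB.
by rewrite trmx_mul Be MT -scalemxAl mulmxN -scalemxAr scalerN scalerA e2 scale1r
  mulNmx mulmxA addNr.
Qed.

(** Skewness of [A] with respect to [B] turns [ad A] into the derivation action on the two vectors.
    The bracket computations below rest on this and [wedge_mul]. *)
Lemma lie_br_wedge A u v : form_lie B A ->
  lie_br A (wedge u v) = wedge (A *m u) v + wedge u (A *m v).
Proof.
move=> [_ /eqP]; rewrite addrC addr_eq0 => /eqP AB.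
rewrite /lie_br mul_wedge /wedge mulmxBl -scalemxAl.
rewrite -!mulmxA AB !mulmxN !trmx_mul !mulmxA scalerN opprB.
rewrite opprK; move: (A *m u *m _ *m _) (A *m v *m _ *m _) => x1 x2.
move: (u *m _ *m _ *m _) (v *m _ *m _ *m _) => x3 x4.
by apply/matrixP => i j; rewrite !mxE; ring.
Qed.

Lemma wedge_sq u v : bf u u = 0 -> bf v v = 0 -> bf u v = 0 ->
  wedge u v *m wedge u v = 0.
Proof.
move=> uu vv uv; rewrite mul_wedge !wedge_mul (bf_sym u v) uu vv uv !mulr0.
by rewrite !scale0r subrr !mul0mx scaler0 subrr.
Qed.

(** The map exchanges the lines of [u] and [v]; going round once multiplies by [bf u u * bf v v] up
    to sign and [e], which is zero. *)
Lemma wedge_cube u v : bf u v = 0 -> bf u u * bf v v = 0 ->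
  wedge u v *m wedge u v *m wedge u v = 0.
Proof.
move=> uv uuvv.
have Nu : wedge u v *m u = - (e * bf u u) *: v.
  by rewrite wedge_mul (bf_sym u v) uv mulr0 scale0r sub0r scaleNr.
have Nv : wedge u v *m v = bf v v *: u.
  by rewrite wedge_mul uv mulr0 scale0r subr0.
have NNu : wedge u v *m wedge u v *m u = 0.
  by rewrite -mulmxA Nu -scalemxAr Nv scalerA mulNr -mulrA uuvv mulr0 oppr0 scale0r.
have NNv : wedge u v *m wedge u v *m v = 0.
  by rewrite -mulmxA Nv -scalemxAr Nu scalerA mulrN mulrCA (mulrC (bf v v)) uuvv
    mulr0 oppr0 scale0r.
by rewrite mul_wedge NNu NNv !mul0mx scaler0 subrr.
Qed.

(** The image of [delta_mx i j] under the projection sending [A] to half of [A - e B^-T A^T B], onto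
    the Lie algebra of the form. *)
Definition form_proj i j : 'M[K]_d :=
  2^-1 *: wedge (delta_mx i 0) (invmx B^T *m delta_mx j 0).

Lemma form_projE A : form_lie B A -> A = \sum_i \sum_j A i j *: form_proj i j.
Proof.
move=> [_ /eqP]; rewrite addr_eq0 => /eqP AB.
have BTu : B^T \in unitmx by rewrite unitmx_tr.
have pE i j : wedge (delta_mx i 0) (invmx B^T *m delta_mx j 0) =
    delta_mx i j - e *: (invmx B^T *m delta_mx j i *m B).
  rewrite /wedge trmx_mul trmx_inv trmxK !trmx_delta mulmxKV//.
  by rewrite mul_delta_mx -!mulmxA (mulmxA (delta_mx j 0)) mul_delta_mx.
have -> : \sum_i \sum_j A i j *: form_proj i j =
    2^-1 *: (A - e *: (invmx B^T *m A^T *m B)).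
  have -> : A^T = \sum_i \sum_j A i j *: delta_mx j i.
    rewrite [LHS]matrix_sum_delta exchange_big/=; apply: eq_bigr => i _.
    by apply: eq_bigr => j _; rewrite mxE.
  rewrite {2}(matrix_sum_delta A).
  rewrite mulmx_sumr mulmx_suml scaler_sumr -sumrB scaler_sumr.
  apply: eq_bigr => i _.
  rewrite mulmx_sumr mulmx_suml scaler_sumr -sumrB scaler_sumr.
  apply: eq_bigr => j _.
  rewrite /form_proj pE -scalemxAr -scalemxAl scalerA mulrC -scalerA.
  by rewrite [in LHS]scalerBr (scalerA e) (mulrC e) -(scalerA _ e).
have -> : invmx B^T *m A^T *m B = - (e *: A).
  rewrite -mulmxA AB mulmxN; congr (- _).
  have -> : B *m A = e *: (B^T *m A) by rewrite Be -scalemxAl scalerA e2 scale1r.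
  by rewrite -scalemxAr mulKmx.
rewrite scalerN opprK scalerA e2 scale1r.
by apply/matrixP => i j; rewrite !mxE; field.
Qed.

Lemma wedge_span (S : set 'M[K]_d) : subspace S -> (forall u v, S (wedge u v)) ->
  form_lie B `<=` S.
Proof.
move=> Ssub Sw A /form_projE ->.
apply: (subspace_sum Ssub) => i _; apply: (subspace_sum Ssub) => j _.
by do 2!apply: (subspaceZ Ssub).
Qed.

Lemma form_projector : exists pr : 'I_d -> 'I_d -> 'M[K]_d,
  (forall i j, form_lie B (pr i j)) /\
  (forall A, form_lie B A -> A = \sum_i \sum_j A i j *: pr i j).
Proof.
exists form_proj; split=> [i j|A]; last exact: form_projE.
exact: (subspaceZ (form_lie_subspace B) _ (form_lie_wedge _ _)).
Qed.

Section WeightBasis.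
Variables (P : 'M[K]_d) (s : 'I_d -> 'I_d) (z : 'I_d -> int) (jj : 'I_d -> K).
Variable o : 'I_d.
Local Notation p k := (col k P).
Local Notation o' := (s o).
Hypothesis wb : weight_basis B P s z jj o.

Let Pu : P \in unitmx := wb_unit wb.
Let sK : involutive s := wb_involutive wb.
Let bfp : forall k m, bf (p k) (p m) = if m == s k then jj k else 0 := wb_form wb.
Let zI : injective z := wb_inj wb.
Let zs : forall k, z (s k) = - z k := wb_opp wb.
Let zo : 0 < z o := wb_pos wb.
Let zmax : forall k, z k <= z o := wb_max wb.

Let l k : K := (z k)%:~R.
Let H := conj_diag P l.

Lemma basis_sum u : u = \sum_k (invmx P *m u) k 0 *: p k.
Proof.
rewrite -[LHS](mulKVmx Pu); move: (invmx P *m u) => v.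
apply/colP => i; rewrite summxE mxE; apply: eq_bigr => k _.
by rewrite [RHS]mxE mulrC; congr (_ * _); rewrite mxE.
Qed.

Lemma subspace_basis (S : set 'cV[K]_d) : subspace S -> (forall k, S (p k)) ->
  forall v, S v.
Proof.
move=> Ssub Sp v; rewrite (basis_sum v); apply: (subspace_sum Ssub) => k _.
exact: (subspaceZ Ssub).
Qed.

Lemma basis_span (S : set 'M[K]_d) : subspace S ->
  (forall k m, S (wedge (p k) (p m))) -> form_lie B `<=` S.
Proof.
move=> Ssub Sw; apply: wedge_span => // u v.
rewrite (basis_sum u) wedge_suml; apply: (subspace_sum Ssub) => k _.
rewrite wedgeZl; apply: (subspaceZ Ssub).
rewrite (basis_sum v) wedge_sumr; apply: (subspace_sum Ssub) => m _.
by rewrite wedgeZr; exact: (subspaceZ Ssub).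
Qed.

Lemma weight_inj : injective l.
Proof. by move=> i j /intr_inj /zI. Qed.

Lemma weight_H : form_lie B H.
Proof.
apply/(form_lie_conj_diag B l Pu); split.
  have : \sum_k l k = - \sum_k l k.
    rewrite {1}(reindex_inj (inv_inj sK))/= -sumrN; apply: eq_bigr => k _.
    by rewrite /l zs rmorphN.
  move=> /eqP; rewrite -addr_eq0 -mulr2n mulrn_eq0/= => /eqP //.
move=> i j.
have -> : (P^T *m B *m P) i j = bf (p i) (p j).
  rewrite /bf tr_col !mxE; apply: eq_bigr => k _; rewrite !mxE; congr (_ * _).
  by apply: eq_bigr => m _; rewrite !mxE.
rewrite bfp; case: eqVneq => [->|_]; last by rewrite mulr0.
by rewrite /l zs rmorphN/= subrr mul0r.
Qed.

Lemma H_basis k : H *m p k = l k *: p k.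
Proof.
rewrite [in LHS]colE mulmxA -colE; apply/colP => m.
rewrite /H /conj_diag mulmxKV// [LHS]mxE mulmx_diagEr.
by rewrite [RHS]mxE [X in _ = _ * X]mxE mulrC.
Qed.

Lemma lie_br_basis k m : lie_br H (wedge (p k) (p m)) =
  (l k + l m) *: wedge (p k) (p m).
Proof.
rewrite (lie_br_wedge _ _ weight_H) !H_basis wedgeZl wedgeZr.
by rewrite -scalerDl.
Qed.

Lemma s_o : o' != o.
Proof.
by clear Bu; apply/eqP => /(congr1 z); rewrite zs => /eqP; lia.
Qed.

(** The components have weights [z k + z o] and [z k - z o]. As [|z k| <= z o], a weight of the
    first kind equals one of the second only when both are zero, from [k = o'] and [k = o]
    respectively; these are the excluded indices. *)
Lemma weight_components (S : set 'M[K]_d) (c : 'I_d -> K) : subspace S ->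
  (forall A, S A -> S (lie_br H A)) ->
  S (wedge (p o + p o') (\sum_k c k *: p k)) ->
  (forall k, k != o' -> S (c k *: wedge (p o) (p k))) /\
  (forall k, k != o -> S (c k *: wedge (p o') (p k))).
Proof.
clear Bu; move=> Ssub SH SN.
pose q (b : bool) := if b then o else o'.
pose v (bk : bool * 'I_d) := c bk.2 *: wedge (p (q bk.1)) (p bk.2).
pose lam (bk : bool * 'I_d) : K := l (q bk.1) + l bk.2.
have Hv bk : lie_br H (v bk) = lam bk *: v bk.
  rewrite /v /lam /lie_br -scalemxAr -scalemxAl -scalerBr -/(lie_br _ _).
  by rewrite lie_br_basis !scalerA mulrC.
have Sv : S (\sum_bk v bk).
  move: SN; rewrite wedgeDl !wedge_sumr -big_split/=.
  rewrite -(pair_bigA _ (fun b k => v (b, k)))/= exchange_big/=; congr S.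
  by apply: eq_bigr => k _; rewrite big_bool/= !wedgeZr.
have key (b : bool) k : k != q (~~ b) -> S (v (b, k)).
  move=> kb; have := subspace_eigen Ssub SH (lie_br_linear Hv) Sv (b, k).
  rewrite (eq_bigl (pred1 (b, k))) ?big_pred1_eq// => -[b' k'] /=.
  rewrite /lam /l/= -!rmorphD/= (inj_eq intr_inj) xpair_eqE -(inj_eq zI).
  have := zmax k; have := zmax k'; have := zmax (s k); have := zmax (s k').
  move: kb; rewrite -(inj_eq zI) !zs.
  by case: b; case: b'; rewrite /q/= ?zs => /eqP kb; lia.
by split=> k ko; [exact: (key true)|exact: (key false)].
Qed.

Lemma wedge_bracket k m : k != o -> k != o' -> m != o -> m != o' ->
  lie_br (wedge (p o) (p k)) (wedge (p o') (p m)) =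
  - (e * jj o) *: wedge (p k) (p m) + bf (p k) (p m) *: wedge (p o') (p o).
Proof.
move=> ko ko' mo mo'.
rewrite lie_br_wedge; last exact: form_lie_wedge.
rewrite !wedge_mul !bfp eqxx.
have -> : (o' == s k) = false by rewrite (inj_eq (inv_inj sK)) eq_sym (negPf ko).
rewrite (negPf mo') mulr0 !scale0r sub0r subr0.
by rewrite -scaleNr wedgeZl wedgeZr.
Qed.

End WeightBasis.
End Bilinear.

(** * Generators for a symmetric form *)

Section Orthogonal.
Variables (K : numFieldType) (d : nat) (B P : 'M[K]_d).
Variables (s : 'I_d -> 'I_d) (z : 'I_d -> int) (jj : 'I_d -> K) (o : 'I_d).
Hypothesis Be : B^T = 1 *: B.
Hypothesis Bu : B \in unitmx.
Hypothesis wb : weight_basis B P s z jj o.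
Local Notation p k := (col k P).
Local Notation o' := (s o).
Local Notation bf := (bf B).
Local Notation wedge := (wedge B 1).
Local Notation H := (conj_diag P (fun k => (z k)%:~R)).

Let e2 : 1 * 1 = 1 :> K := mulr1 1.
Let sK := wb_involutive wb.
Let bfp := wb_form wb.
Let o'o : o' != o := s_o wb.

Lemma orth_s k m : (s k == s m) = (k == m).
Proof. exact: (inj_eq (inv_inj sK)). Qed.

Lemma orth_sC k m : (s k == m) = (k == s m).
Proof. by rewrite -{1}(sK m) orth_s. Qed.

Lemma orth_wedgeC u v : wedge v u = - wedge u v.
Proof. by rewrite (wedgeC B e2) scaleN1r. Qed.

Lemma orth_wedge_id u : wedge u u = 0.
Proof. exact: wedge_id. Qed.

Lemma orth_swap (S : set 'M[K]_d) u v : subspace S -> S (wedge u v) -> S (wedge v u).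
Proof. by move=> Ssub Sw; rewrite orth_wedgeC; exact: (subspaceN Ssub). Qed.

(** Adding the brackets for the pairs [(k1, s k1)] and [(s k1, k1)] cancels the antisymmetric wedge
    and doubles the symmetric pairing, which isolates [wedge (p o') (p o)]. The weak condition on
    brackets serves both subalgebras and ideals. *)
Lemma orth_span (S : set 'M[K]_d) k1 : subspace S ->
  (forall A C, form_lie B A -> S A -> S C -> S (lie_br A C)) ->
  (forall k, k != o -> k != o' -> S (wedge (p o) (p k))) ->
  (forall k, k != o -> k != o' -> S (wedge (p o') (p k))) ->
  k1 != o -> k1 != o' -> form_lie B `<=` S.
Proof.
move=> Ssub Sbr So So' k1o k1o'.
have br k m (ko : k != o) (ko' : k != o') (mo : m != o) (mo' : m != o') :
    S (- (1 * jj o) *: wedge (p k) (p m) + bf (p k) (p m) *: wedge (p o') (p o)).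
  rewrite -(wedge_bracket Be e2 wb)//.
  by apply: Sbr; [exact: form_lie_wedge|exact: So|exact: So'].
have Soo' : S (wedge (p o') (p o)).
  have sk1o : s k1 != o by rewrite orth_sC.
  have sk1o' : s k1 != o' by rewrite orth_s.
  have b1 := br _ _ k1o k1o' sk1o sk1o'; have b2 := br _ _ sk1o sk1o' k1o k1o'.
  have := subspaceD Ssub b1 b2.
  rewrite (bf_sym Be (p k1)) mul1r !bfp eqxx (orth_wedgeC (p k1)) scalerN.
  rewrite addrACA subrr add0r -scalerDl; apply: subspaceZK => //.
  by rewrite mul1r -mulr2n mulrn_eq0 negb_or/= (wb_nz wb).
have Skm k m (ko : k != o) (ko' : k != o') (mo : m != o) (mo' : m != o') :
    S (wedge (p k) (p m)).
  have := subspaceB Ssub (br _ _ ko ko' mo mo')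
    (subspaceZ Ssub (bf (p k) (p m)) Soo').
  rewrite addrK; apply: subspaceZK => //.
  by rewrite oppr_eq0 mul1r (wb_nz wb).
suff Sall k m : S (wedge (p k) (p m)).
  exact: (basis_span Be e2 Bu wb Ssub Sall).
have [->|ko] := eqVneq k o; have [->|mo] := eqVneq m o.
- by rewrite orth_wedge_id; exact: subspace0.
- have [->|mo'] := eqVneq m o'; first exact: orth_swap.
  exact: So.
- have [->//|ko'] := eqVneq k o'.
  by apply: orth_swap => //; exact: So.
have [->|ko'] := eqVneq k o'; have [->|mo'] := eqVneq m o'.
- by rewrite orth_wedge_id; exact: subspace0.
- exact: So'.
- by apply: orth_swap => //; exact: So'.
- exact: Skm.
Qed.

Section Generators.
Variables (k1 k2 : 'I_d) (c : 'I_d -> K).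
Hypothesis k1o : k1 != o.
Hypothesis k1o' : k1 != o'.
Hypothesis k1k1 : s k1 != k1.
Hypothesis k2n : [&& k2 != o, k2 != o', k2 != k1 & k2 != s k1].
Hypothesis zk1 : 0 < z k1.
Hypothesis co : c o = 0.
Hypothesis co' : c o' = 0.
Hypothesis cn : forall k, k != o -> k != o' -> c k != 0.
Hypothesis cc : \sum_k c k * c (s k) * jj k = 0.

Lemma orth_Lie (S : set 'M[K]_d) : subspace S ->
  (forall A C, S A -> S C -> S (lie_br A C)) ->
  (forall A, S A -> S (lie_br H A)) ->
  S (wedge (p o + p o') (\sum_k c k *: p k)) -> form_lie B `<=` S.
Proof.
move=> Ssub Sbr SH SN.
have [S1 S2] := weight_components wb Ssub SH SN.
have So k (ko : k != o) (ko' : k != o') : S (wedge (p o) (p k)).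
  by apply: (subspaceZK Ssub (cn ko ko')); exact: S1.
have So' k (ko : k != o) (ko' : k != o') : S (wedge (p o') (p k)).
  by apply: (subspaceZK Ssub (cn ko ko')); exact: S2.
exact: (orth_span Ssub (fun A C _ => @Sbr A C) So So' k1o k1o').
Qed.

(** Bracketing with [wedge (p k) (p (s j))] sends [p j] to a multiple of [p k] and kills [p i]. *)
Lemma orth_move (S : set 'M[K]_d) i j k : subspace S ->
  (forall A C, form_lie B A -> S C -> S (lie_br A C)) ->
  i != j -> k != s i -> k != s j ->
  S (wedge (p i) (p j)) -> S (wedge (p i) (p k)).
Proof.
move=> Ssub Sbr ij ki kj Sij.
have gA : form_lie B (wedge (p k) (p (s j))) by exact: form_lie_wedge.
have := Sbr _ _ gA Sij; rewrite lie_br_wedge//.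
have bki : bf (p k) (p i) = 0 by rewrite bfp -orth_sC eq_sym (negPf ki).
have bkj : bf (p k) (p j) = 0 by rewrite bfp -orth_sC eq_sym (negPf kj).
rewrite !wedge_mul !bfp sK eqxx (negPf ij) -!bfp bki bkj !mulr0 !scale0r !subr0.
rewrite wedge0l add0r wedgeZr; apply: subspaceZK => //.
exact: (wb_nz wb).
Qed.

Lemma orth_ideal (S : set 'M[K]_d) : subspace S ->
  (forall A C, form_lie B A -> S C -> S (lie_br A C)) ->
  S (wedge (p o) (p k1)) -> form_lie B `<=` S.
Proof.
move=> Ssub Sbr SE; have /and4P[k2o k2o' k2k1 k2k1'] := k2n.
have k1'o : s k1 != o by rewrite orth_sC.
have k1'o' : s k1 != o' by rewrite orth_s.
have k2'k1 : s k2 != k1 by rewrite orth_sC.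
have k2'o : s k2 != o by rewrite orth_sC.
have ok k : k != o' -> S (wedge (p o) (p k)).
  move=> ko'; have [->|kk1'] := eqVneq k (s k1); last first.
    by apply: (orth_move Ssub Sbr _ ko' kk1' SE); rewrite eq_sym.
  (* [orth_move] cannot pass from [k1] to its dual directly; the detour through [k2] uses an index
     outside the two dual pairs. *)
  have S2 : S (wedge (p o) (p k2)).
    by apply: (orth_move Ssub Sbr _ _ _ SE); rewrite // eq_sym.
  by apply: (orth_move Ssub Sbr _ k1'o' _ S2); rewrite ?orth_s eq_sym.
have ok' k : k != o -> k != o' -> S (wedge (p o') (p k)).
  move=> ko ko'.
  have [m [mk mk' mo mo']] : exists m, [/\ m != k, m != s k, m != o & m != o'].
    have [->|kk1] := eqVneq k k1; first by exists k2.
    have [->|kk1'] := eqVneq k (s k1); first by exists k2; rewrite sK.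
    by exists k1; split=> //; rewrite eq_sym// orth_sC.
  apply: orth_swap => //.
  have Sko : S (wedge (p k) (p o)) by apply: orth_swap => //; exact: ok.
  have Skm := orth_move Ssub Sbr ko mk' mo' Sko.
  by apply: (orth_move Ssub Sbr _ _ _ Skm); rewrite ?orth_s eq_sym.
exact: (orth_span Ssub (fun A C gA _ => Sbr A C gA) (fun k _ => ok k) ok' k1o k1o').
Qed.

(** [E] kills [p o] and [p k1], whose weights are positive, so the scalars are nonzero. From [p o]
    every [p k] with [k != o'] is reached, and [p o'] is reached from [p k1]. *)
Lemma orth_vectors (S : set 'cV[K]_d) : subspace S ->
  (forall A k, form_lie B A -> wedge (p o) (p k1) *m p k = 0 ->
    (z k)%:~R + ((z o)%:~R + (z k1)%:~R) != 0 :> K -> S (A *m p k)) ->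
  forall v, S v.
Proof.
move=> Ssub SA; apply: (subspace_basis wb Ssub) => k.
have zo := wb_pos wb.
have nz (x y t : int) : 0 < x -> 0 < y -> 0 < t ->
    x%:~R + (y%:~R + t%:~R) != 0 :> K.
  by move=> x0 y0 t0; rewrite -!rmorphD/= intr_eq0; apply/eqP; lia.
have k1'o : s k1 != o by rewrite orth_sC.
have Eo : wedge (p o) (p k1) *m p o = 0.
  rewrite wedge_mul !bfp (eq_sym o (s k1)) (negPf k1'o).
  by rewrite (eq_sym o) (negPf o'o) mulr0 !scale0r subrr.
have Ek1 : wedge (p o) (p k1) *m p k1 = 0.
  rewrite wedge_mul !bfp (eq_sym k1 (s k1)) (negPf k1k1).
  by rewrite (negPf k1o') mulr0 !scale0r subrr.
have [->|ko'] := eqVneq k o'.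
  have := SA _ _ (form_lie_wedge Be e2 (p o') (p (s k1))) Ek1 (nz _ _ _ zk1 zo zk1).
  rewrite wedge_mul !bfp !sK eqxx (negPf k1o) mulr0 scale0r subr0.
  by apply: subspaceZK => //; exact: (wb_nz wb).
have := SA _ _ (form_lie_wedge Be e2 (p k) (p o')) Eo (nz _ _ _ zo zo zk1).
rewrite wedge_mul !bfp sK eqxx -orth_sC eq_sym (negPf ko').
rewrite mulr0 scale0r subr0.
by apply: subspaceZK => //; exact: (wb_nz wb).
Qed.

Lemma orth_generators :
  (forall S : set 'M[K]_d, subspace S ->
    (forall A, form_lie B A -> A *m A *m A = 0 -> S A) -> form_lie B `<=` S) ->
  generators B P (fun k => (z k)%:~R) (wedge (p o + p o') (\sum_k c k *: p k))
    (wedge (p o) (p k1)) ((z o)%:~R + (z k1)%:~R).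
Proof.
move=> nil; have bo k : k != o' -> bf (p o) (p k) = 0.
  by move=> ko; rewrite bfp (negPf ko).
split=> //.
- exact: wb_unit wb.
- exact: weight_inj wb.
- exact: weight_H wb.
- exact: form_lie_wedge.
(* The two factors are orthogonal because [c] vanishes at [o] and [o']; the second one is isotropic
   by [cc]. *)
- apply: (wedge_cube Be).
    rewrite bf_sumr big1// => k _; rewrite bfZr bfDl !bfp sK.
    have [->|ko] := eqVneq k o; first by rewrite co mul0r.
    have [->|ko'] := eqVneq k o'; first by rewrite co' mul0r.
    by rewrite addr0 mulr0.
  rewrite [X in _ * X](_ : _ = 0) ?mulr0// -[RHS]cc bf_suml.
  apply: eq_bigr => k _; rewrite bfZl bf_sumr (bigD1 (s k))//= bfZr bfp eqxx.
  rewrite big1 ?addr0 ?mulrA// => m mk.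
  by rewrite bfZr bfp (negPf mk) mulr0.
- exact: form_lie_wedge.
- apply: (wedge_sq Be); rewrite bfp.
  + by rewrite eq_sym (negPf o'o).
  + by rewrite eq_sym (negPf k1k1).
  + by rewrite (negPf k1o').
- exact: (lie_br_basis _ wb).
- exact: orth_Lie.
- exact: orth_ideal.
- exact: orth_vectors.
- exact: (form_projector Be e2 Bu).
Qed.

End Generators.
End Orthogonal.

(** * Generators for an alternating form *)

Section Symplectic.
Variables (K : numFieldType) (d : nat) (B P : 'M[K]_d).
Variables (s : 'I_d -> 'I_d) (z : 'I_d -> int) (jj : 'I_d -> K) (o : 'I_d).
Hypothesis Be : B^T = -1 *: B.
Hypothesis Bu : B \in unitmx.
Hypothesis wb : weight_basis B P s z jj o.
Local Notation p k := (col k P).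
Local Notation o' := (s o).
Local Notation bf := (bf B).
Local Notation wedge := (wedge B (-1)).
Local Notation H := (conj_diag P (fun k => (z k)%:~R)).

Let e2 : -1 * -1 = 1 :> K. Proof. by rewrite mulrNN mulr1. Qed.
Let sK := wb_involutive wb.
Let bfp := wb_form wb.
Let o'o : o' != o := s_o wb.

Lemma symp_wedgeC u v : wedge v u = wedge u v.
Proof. by rewrite (wedgeC B e2) opprK scale1r. Qed.

Lemma symp_bf_sym u v : bf v u = - bf u v.
Proof. by rewrite (bf_sym Be) mulN1r. Qed.

Lemma symp_bf_id u : bf u u = 0.
Proof.
have /eqP := symp_bf_sym u u.
by rewrite -addr_eq0 -mulr2n mulrn_eq0/= => /eqP.
Qed.

Lemma symp_wedge_mul u v w : wedge u v *m w = bf v w *: u + bf u w *: v.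
Proof. by rewrite wedge_mul mulN1r scaleNr opprK. Qed.

Let bfoo' : bf (p o') (p o) != 0.
Proof. by rewrite bfp sK eqxx; exact: (wb_nz wb). Qed.

(** The wedge is symmetric here, so the squares of [p o] and [p o'] are available; their bracket
    gives the component [wedge (p o') (p o)], which the weights alone do not isolate. *)
Lemma symp_Lie (S : set 'M[K]_d) : subspace S ->
  (forall A C, S A -> S C -> S (lie_br A C)) ->
  (forall A, S A -> S (lie_br H A)) ->
  S (wedge (p o + p o') (\sum_k 1 *: p k)) -> form_lie B `<=` S.
Proof.
move=> Ssub Sbr SH SN.
have [S1 S2] := weight_components wb Ssub SH SN.
have So k : k != o' -> S (wedge (p o) (p k)) by move=> /S1; rewrite scale1r.
have So' k : k != o -> S (wedge (p o') (p k)) by move=> /S2; rewrite scale1r.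
have Soo' : S (wedge (p o') (p o)).
  have oo' : o != o' by rewrite eq_sym.
  have Soo := So _ oo'.
  have := Sbr _ _ Soo (So' _ o'o).
  rewrite lie_br_wedge; last exact: form_lie_wedge.
  rewrite !symp_wedge_mul (symp_bf_sym (p o') (p o)) -scalerDl.
  rewrite wedgeZl wedgeZr (symp_wedgeC (p o')) -scalerDl.
  by apply: subspaceZK => //; rewrite -!mulr2n !mulrn_eq0/= oppr_eq0.
have Skm k m (ko : k != o) (ko' : k != o') (mo : m != o) (mo' : m != o') :
    S (wedge (p k) (p m)).
  have := Sbr _ _ (So k ko') (So' m mo); rewrite (wedge_bracket Be e2 wb)// => br.
  have := subspaceB Ssub br (subspaceZ Ssub (bf (p k) (p m)) Soo').
  rewrite addrK; apply: subspaceZK => //.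
  by rewrite mulN1r opprK (wb_nz wb).
suff Sall k m : S (wedge (p k) (p m)).
  exact: (basis_span Be e2 Bu wb Ssub Sall).
have [->|ko] := eqVneq k o.
  have [->|mo'] := eqVneq m o'; first by rewrite symp_wedgeC.
  exact: So.
have [->|ko'] := eqVneq k o'.
  have [->//|mo] := eqVneq m o.
  exact: So'.
have [->|mo] := eqVneq m o; first by rewrite symp_wedgeC; exact: So.
have [->|mo'] := eqVneq m o'; first by rewrite symp_wedgeC; exact: So'.
exact: Skm.
Qed.

(* [wedge q q] and [wedge v q], with [q] dual to [x], map [x] to multiples of [q]
   and, modulo [q], of [v]. *)
Lemma symp_ideal (S : set 'M[K]_d) : subspace S ->
  (forall A C, form_lie B A -> S C -> S (lie_br A C)) ->
  S (wedge (p o) (p o)) -> form_lie B `<=` S.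
Proof.
move=> Ssub Sbr; have := bfoo'; set q := p o'; set x := p o => qx SE.
have gw u v : form_lie B (wedge u v) by exact: form_lie_wedge.
have half A : S (A + A) -> S A.
  by rewrite -mulr2n -scaler_nat; apply: subspaceZK => //; rewrite pnatr_eq0.
have Dx : wedge q q *m x = (bf q x *+ 2) *: q.
  by rewrite symp_wedge_mul -scalerDl mulr2n.
have Cx v : wedge v q *m x = bf q x *: v + bf v x *: q by exact: symp_wedge_mul.
have qx2 : bf q x *+ 2 != 0 by rewrite mulrn_eq0.
have Sqx : S (wedge q x).
  have := Sbr _ _ (gw q q) SE; rewrite lie_br_wedge// Dx (symp_wedgeC _ x) => /half.
  by rewrite wedgeZl; apply: subspaceZK.
have Sx v : S (wedge v x).
  have := Sbr _ _ (gw v q) SE; rewrite lie_br_wedge// (symp_wedgeC _ x) => /half.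
  rewrite Cx wedgeDl !wedgeZl => Sv.
  have := subspaceB Ssub Sv (subspaceZ Ssub (bf v x) Sqx).
  by rewrite addrK; apply: subspaceZK.
have Sq v : S (wedge v q).
  have := Sbr _ _ (gw q q) (Sx v); rewrite lie_br_wedge// Dx => Sv.
  have := subspaceB Ssub Sv (Sx (wedge q q *m v)).
  by rewrite addrC addKr wedgeZr; apply: subspaceZK.
suff Sall u v : S (wedge u v) by exact: (wedge_span Be e2 Bu Ssub Sall).
have := Sbr _ _ (gw v q) (Sx u); rewrite lie_br_wedge// Cx => Sv.
have := subspaceB Ssub Sv (Sx (wedge v q *m u)).
rewrite addrC addKr wedgeDr !wedgeZr => {}Sv.
have := subspaceB Ssub Sv (subspaceZ Ssub (bf v x) (Sq u)).
by rewrite addrK; apply: subspaceZK.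
Qed.

(** The vector [p o] suffices: [wedge v (p o')] maps it to a nonzero multiple of [v] plus a multiple
    of [p o'], and [v = p o'] shows that the latter is in [S]. *)
Lemma symp_vectors (S : set 'cV[K]_d) : subspace S ->
  (forall A k, form_lie B A -> wedge (p o) (p o) *m p k = 0 ->
    (z k)%:~R + ((z o)%:~R + (z o)%:~R) != 0 :> K -> S (A *m p k)) ->
  forall v, S v.
Proof.
move=> Ssub SA; have zo := wb_pos wb.
have Eo : wedge (p o) (p o) *m p o = 0.
  by rewrite symp_wedge_mul symp_bf_id !scale0r addr0.
have nz : (z o)%:~R + ((z o)%:~R + (z o)%:~R) != 0 :> K.
  by rewrite -!rmorphD/= intr_eq0; apply/eqP; lia.
have Sv v : S (wedge v (p o') *m p o) by apply: SA => //; exact: form_lie_wedge.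
have So' : S (p o').
  have := Sv (p o'); rewrite symp_wedge_mul -scalerDl.
  by apply: subspaceZK => //; rewrite -mulr2n mulrn_eq0/=.
move=> v; have := subspaceB Ssub (Sv v) (subspaceZ Ssub (bf v (p o)) So').
by rewrite symp_wedge_mul addrK; apply: subspaceZK.
Qed.

(** The squares [wedge u u] have cube zero since every vector is isotropic; polarization recovers
    all wedges. *)
Lemma symp_nilpotent (S : set 'M[K]_d) : subspace S ->
  (forall A, form_lie B A -> A *m A *m A = 0 -> S A) -> form_lie B `<=` S.
Proof.
move=> Ssub SA.
have Sw u : S (wedge u u).
  apply: SA; first exact: form_lie_wedge.
  by apply: (wedge_cube Be); rewrite !symp_bf_id ?mulr0.
suff Sall u v : S (wedge u v) by exact: (wedge_span Be e2 Bu Ssub Sall).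
have := subspaceB Ssub (subspaceB Ssub (Sw (u + v)) (Sw u)) (Sw v).
rewrite wedgeDl !wedgeDr (symp_wedgeC u v) => Suv.
apply: (subspaceZK Ssub (a := 2)); first by rewrite pnatr_eq0.
suff <- : wedge u u + wedge u v + (wedge u v + wedge v v) - wedge u u -
  wedge v v = 2 *: wedge u v by [].
by apply/matrixP => i j; rewrite !mxE; ring.
Qed.

Lemma symp_generators :
  generators B P (fun k => (z k)%:~R) (wedge (p o + p o') (\sum_k 1 *: p k))
    (wedge (p o) (p o)) ((z o)%:~R + (z o)%:~R).
Proof.
split.
- exact: wb_unit wb.
- exact: weight_inj wb.
- exact: weight_H wb.
- exact: form_lie_wedge.
- apply: (wedge_cube Be); last by rewrite !symp_bf_id mulr0.
  (* Only the terms at [o] and [o'] pair with the first factor, and they cancel by antisymmetry. *)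
  rewrite bf_sumr (bigD1 o)//= (bigD1 o')//= big1 => [|k /andP[ko ko']].
    rewrite !scale1r !bfDl !symp_bf_id addr0 add0r addr0.
    by rewrite (symp_bf_sym (p o)) addNr.
  rewrite scale1r bfDl !bfp sK (negPf ko) (negPf ko') addr0.
  by [].
- exact: form_lie_wedge.
- by apply: (wedge_sq Be); rewrite symp_bf_id.
- exact: (lie_br_basis _ wb).
- exact: symp_Lie.
- exact: symp_ideal.
- exact: symp_vectors.
- exact: symp_nilpotent.
- exact: (form_projector Be e2 Bu).
Qed.

End Symplectic.

(** * The classical groups *)

Section SymplecticGroup.
Variables (K : numFieldType) (n : nat).
Hypothesis n_gt0 : (0 < n)%N.

Lemma Sp_form_group : @Sp K n = form_group (Omega K n).
Proof. by []. Qed.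

Lemma Omega_tr : (Omega K n)^T = -1 *: Omega K n.
Proof.
rewrite /Omega tr_block_mx !trmx0 linearN/= trmx1 scale_block_mx.
by rewrite !scaler0 scalerN !scaleN1r opprK.
Qed.

Lemma Omega_unit : Omega K n \in unitmx.
Proof.
suff : Omega K n *m - Omega K n = 1%:M by case/mulmx1_unit.
rewrite mulmxN /Omega mulmx_block opp_block_mx scalar_mx_block.
by rewrite !(mulmx0, mul0mx, mulmx1, mul1mx, addr0, add0r, oppr0, opprK).
Qed.

Definition symp_dual (k : 'I_(n + n)) : 'I_(n + n) :=
  match fintype.split k with inl i => rshift n i | inr i => lshift n i end.

(** The values [n, ..., 1] and [-n, ..., -1]: duality negates them, and skipping 0 keeps them
    distinct. *)
Definition symp_weight (k : 'I_(n + n)) : int :=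
  match fintype.split k with inl i => (n - i)%N%:Z | inr i => - (n - i)%N%:Z end.

Definition symp_sign (k : 'I_(n + n)) : K :=
  match fintype.split k with inl _ => 1 | inr _ => -1 end.

Lemma split_lshift (i : 'I_n) : fintype.split (lshift n i) = inl i.
Proof. exact: (unsplitK (inl i)). Qed.

Lemma split_rshift (i : 'I_n) : fintype.split (rshift n i) = inr i.
Proof. exact: (unsplitK (inr i)). Qed.

Lemma symp_weight_basis : weight_basis (Omega K n) 1%:M symp_dual symp_weight
  symp_sign (lshift n (Ordinal n_gt0)).
Proof.
have bfO k m : bf (Omega K n) (col k 1%:M) (col m 1%:M) = Omega K n k m.
  by rewrite /bf !col1 trmx_delta -rowE -colE [LHS]mxE [LHS]mxE.
split.
- exact: unitmx1.
- move=> k; rewrite /symp_dual; case: (split_ordP k) => i ->.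
    by rewrite ?split_lshift ?split_rshift.
  by rewrite ?split_rshift ?split_lshift.
- move=> k m; rewrite bfO /symp_dual /symp_sign /Omega.
  case: (split_ordP k) => i ->; case: (split_ordP m) => j ->;
    rewrite ?split_lshift ?split_rshift
      ?(block_mxEul, block_mxEur, block_mxEdl, block_mxEdr) !mxE.
  + by rewrite eq_lrshift.
  + by rewrite (inj_eq (@rshift_inj _ _)) eq_sym; case: eqP.
  + by rewrite (inj_eq (@lshift_inj _ _)) eq_sym; case: eqP; rewrite ?oppr0.
  + by rewrite eq_rlshift.
- by move=> k; rewrite /symp_sign; case: fintype.split => _;
    rewrite ?oppr_eq0 oner_neq0.
- move=> k m; rewrite /symp_weight.
  case: (split_ordP k) => i ->; case: (split_ordP m) => j ->;
    rewrite ?split_lshift ?split_rshift => h;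
    have := ltn_ord i; have := ltn_ord j => hj hi.
  + by congr (lshift _ _); apply: val_inj => /=; lia.
  + by exfalso; lia.
  + by exfalso; lia.
  + by congr (rshift _ _); apply: val_inj => /=; lia.
- move=> k; rewrite /symp_weight /symp_dual; case: (split_ordP k) => i _.
    by rewrite ?split_lshift ?split_rshift.
  by rewrite ?split_rshift ?split_lshift opprK.
- by rewrite /symp_weight split_lshift /=; lia.
- move=> k; rewrite /symp_weight split_lshift /=.
  by case: (split_ordP k) => i _; lia.
Qed.

Lemma Sp_generators : exists P l N E a, generators (Omega K n) P l N E a.
Proof.
have := symp_generators Omega_tr Omega_unit symp_weight_basis.
by move=> ?; do 5!eexists; eassumption.
Qed.

End SymplecticGroup.

(** * The special orthogonal group *)

Section OrthogonalGroup.
Variables (K : numFieldType) (n : nat) (im : K).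
Hypothesis im2 : im * im = -1.
Hypothesis n5 : (5 <= n)%N.

Lemma SO_form_group : @SO K n = form_group 1%:M.
Proof. by apply/funext => x; rewrite /SO /form_group/= mulmx1. Qed.

Definition rev_mx : 'M[K]_n := \matrix_(i, j) (j == rev_ord i)%:R.

(** With [im^2 = -1] the column [e_k + im e_k'], where [k'] is the reversed index, pairs only with
    column [k'], and always to [2 im]. For odd [n] the middle column is [(1 + im) e_k], of square
    [2 im], so no special case arises. *)
Definition witt_mx : 'M[K]_n := 1%:M + im *: rev_mx.

Lemma rev_mx_tr : rev_mx^T = rev_mx.
Proof.
apply/matrixP => i j; rewrite !mxE; congr (_%:R).
by rewrite -(inj_eq rev_ord_inj) rev_ordK eq_sym.
Qed.

Lemma rev_mx_sq : rev_mx *m rev_mx = 1%:M.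
Proof.
apply/matrixP => i j; rewrite !mxE (bigD1 (rev_ord i))//= !mxE eqxx mul1r.
rewrite rev_ordK big1 ?addr0 => [|k ki]; first by rewrite eq_sym.
by rewrite !mxE (negPf ki) mul0r.
Qed.

Lemma witt_mx_unit : witt_mx \in unitmx.
Proof.
suff : witt_mx *m (2^-1 *: (1%:M - im *: rev_mx)) = 1%:M by case/mulmx1_unit.
rewrite -scalemxAr /witt_mx mulmxDl mul1mx mulmxBr mulmx1 -scalemxAl -scalemxAr.
rewrite rev_mx_sq scalerA im2; move: rev_mx => Q.
by apply/matrixP => i j; rewrite !mxE; field.
Qed.

Lemma witt_mx_form : witt_mx^T *m witt_mx = (2 * im) *: rev_mx.
Proof.
have -> : witt_mx^T = witt_mx.
  by rewrite /witt_mx [LHS]linearD/= trmx1 [X in _ + X]linearZ/= rev_mx_tr.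
rewrite /witt_mx mulmxDl mul1mx.
rewrite mulmxDr mulmx1 -!scalemxAl -scalemxAr rev_mx_sq scalerA im2.
by move: rev_mx => Q; apply/matrixP => i j; rewrite !mxE; ring.
Qed.

(** Reversal of the indices negates these values; the step of two keeps them integral for both
    parities of [n]. *)
Definition orth_weight (k : 'I_n) : int := n%:Z - 1 - (2 * k)%N%:Z.

Lemma im_neq0 : im != 0.
Proof.
by apply: contra_eq_neq im2 => ->; rewrite mul0r eq_sym oppr_eq0 oner_neq0.
Qed.

Let o : 'I_n := Ordinal (leq_trans (isT : (0 < 5)%N) n5).
Let k1 : 'I_n := Ordinal (leq_trans (isT : (1 < 5)%N) n5).
Let k2 : 'I_n := Ordinal (leq_trans (isT : (2 < 5)%N) n5).

Lemma orth_weight_basis :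
  weight_basis 1%:M witt_mx (@rev_ord n) orth_weight (fun=> 2 * im) o.
Proof.
split.
- exact: witt_mx_unit.
- exact: rev_ordK.
- move=> k m; rewrite /bf mulmx1.
  have -> : ((col k witt_mx)^T *m col m witt_mx) 0 0 = (witt_mx^T *m witt_mx) k m.
    by rewrite !mxE; apply: eq_bigr => i _; rewrite ![col _ _ _ _]mxE !mxE.
  rewrite witt_mx_form mxE [rev_mx _ _]mxE.
  by case: eqP; rewrite ?mulr1 ?mulr0.
- by move=> _; rewrite mulf_neq0 ?pnatr_eq0// im_neq0.
- by move=> i j; rewrite /orth_weight => h; apply: val_inj => /=; lia.
- by move=> k; rewrite /orth_weight/=; have := ltn_ord k; lia.
- by rewrite /orth_weight/=; lia.
- by move=> k; rewrite /orth_weight/=; lia.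
Qed.

(** With a third index [k] and [c^2 = -1] the vector [d i + c *: d k] is isotropic, so its wedge
    with [d j] has cube zero. Adding the cases [c = im] and [c = - im] leaves twice
    [wedge (d i) (d j)]. *)
Lemma orth_nilpotent (S : set 'M[K]_n) : subspace S ->
  (forall A, form_lie 1%:M A -> A *m A *m A = 0 -> S A) -> form_lie 1%:M `<=` S.
Proof.
move=> Ssub SA.
have Be : (1%:M : 'M[K]_n)^T = 1 *: 1%:M by rewrite trmx1 scale1r.
have e2 : 1 * 1 = 1 :> K := mulr1 1.
pose d (i : 'I_n) : 'cV[K]_n := delta_mx i 0.
have bfd i j : bf 1%:M (d i) (d j) = (i == j)%:R.
  by rewrite /bf mulmx1 trmx_delta -rowE !mxE eqxx andbT.
suff Sd i j : S (wedge 1%:M 1 (d i) (d j)).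
  apply: (wedge_span Be e2 (unitmx1 _ _) Ssub) => u v.
  have dE (w : 'cV[K]_n) : w = \sum_i w i 0 *: d i.
    by rewrite [LHS](matrix_sum_delta w); apply: eq_bigr => k _; rewrite big_ord1.
  rewrite (dE u) wedge_suml; apply: (subspace_sum Ssub) => k _.
  rewrite wedgeZl; apply: (subspaceZ Ssub).
  rewrite (dE v) wedge_sumr; apply: (subspace_sum Ssub) => m _.
  by rewrite wedgeZr; exact: (subspaceZ Ssub).
have [<-|ij] := eqVneq i j; first by rewrite wedge_id//; exact: subspace0.
have [k ki kj] : exists2 k, k != i & k != j.
  have [oi|oi] := boolP ((o != i) && (o != j)); first by exists o; case/andP: oi.
  have [oi1|oi1] := boolP ((k1 != i) && (k1 != j)).
    by exists k1; case/andP: oi1.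
  exists k2; move: oi oi1 ij; rewrite -!(inj_eq val_inj)/=; lia.
have nil c : c * c = -1 -> S (wedge 1%:M 1 (d i + c *: d k) (d j)).
  move=> cc; apply: SA; first exact: form_lie_wedge.
  apply: (wedge_cube Be).
    by rewrite bfDl bfZl !bfd (negPf ij) (negPf kj) mulr0 addr0.
  rewrite bfDl !bfDr !bfZl !bfZr !bfd !eqxx (negPf ki) eq_sym (negPf ki).
  by rewrite !(mulr0, mulr1, addr0, add0r) cc subrr.
have imN : - im * - im = -1 by rewrite mulrNN.
have := subspaceD Ssub (nil _ im2) (nil _ imN).
rewrite !wedgeDl scaleNr -scaleN1r !wedgeZl scaleN1r addrACA subrr addr0.
by rewrite -mulr2n -scaler_nat; apply: subspaceZK; rewrite ?pnatr_eq0.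
Qed.

Lemma SO_generators : exists P l N E a, generators (1%:M : 'M[K]_n) P l N E a.
Proof.
have Be : (1%:M : 'M[K]_n)^T = 1 *: 1%:M by rewrite trmx1 scale1r.
pose r := @rev_ord n.
have rE (k : 'I_n) : r k = (n - k.+1)%N :> nat by [].
have ne (i j : 'I_n) : (i == j) = (i == j :> nat) by rewrite -(inj_eq val_inj).
have k1o : k1 != o by [].
have k1o' : k1 != r o by rewrite ne rE/=; lia.
have k1k1 : r k1 != k1 by rewrite ne rE/=; lia.
have k2n : [&& k2 != o, k2 != r o, k2 != k1 & k2 != r k1].
  by rewrite !ne !rE/=; lia.
have zk1 : 0 < orth_weight k1 by rewrite /orth_weight/=; lia.
pose Q := [pred k : 'I_n | [&& k != o, k != r o, k != k1 & k != r k1]].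
have Q0 : (#|Q|)%:R != 0 :> K.
  by rewrite pnatr_eq0 -lt0n; apply/card_gt0P; exists k2.
(* Isotropy of the vector: [k1] and its dual contribute [x] each and every index of [Q] contributes
   1, so [2 x + #|Q| = 0]; [x] is nonzero because [k2] is in [Q]. *)
pose x : K := - (#|Q|)%:R / 2.
pose c k : K := if (k == o) || (k == r o) then 0 else if k == k1 then x else 1.
have co : c o = 0 by rewrite /c eqxx.
have co' : c (r o) = 0 by rewrite /c eqxx orbT.
have cn k : k != o -> k != r o -> c k != 0.
  move=> ko ko'; rewrite /c (negPf ko) (negPf ko')/=; case: (eqVneq k k1) => _.
    by rewrite /x mulf_eq0 oppr_eq0 invr_eq0 (negPf Q0) pnatr_eq0.
  exact: oner_neq0.
have rr k : (r k == o) = (k == r o) by rewrite -{1}(rev_ordK o) (inj_eq rev_ord_inj).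
have rro k : (r k == r o) = (k == o) by rewrite (inj_eq rev_ord_inj).
have ck1 : c k1 = x by rewrite /c (negPf k1o) (negPf k1o') eqxx.
have crk1 : c (r k1) = 1.
  by rewrite /c rr rro (negPf k1o) (negPf k1o') (negPf k1k1).
have cc : \sum_k c k * c (r k) * (2 * im) = 0.
  rewrite -mulr_suml (bigD1 k1)//= (bigD1 (r k1)) //=.
  rewrite (rev_ordK k1 : r (r k1) = k1) ck1 crk1 mul1r mulr1.
  rewrite (bigID Q)/= [X in x + (x + (X + _))](eq_bigr (fun=> 1)); last first.
    move=> k /andP[_ /and4P[ko ko' kk1 kk1']].
    rewrite /c rr rro (negPf ko) (negPf ko') (negPf kk1) orbF.
    have -> : (r k == k1) = false.
      by rewrite -{1}(rev_ordK k1) (inj_eq rev_ord_inj) (negPf kk1').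
    by rewrite mulr1.
  rewrite [X in x + (x + (_ + X))]big1 ?addr0; last first.
    move=> k /andP[/andP[kk1 kk1'] kQ]; move: kQ; rewrite kk1 kk1' !andbT negb_and.
    rewrite !negbK => /orP[/eqP ->|/eqP ->]; first by rewrite co mul0r.
    by rewrite co' mul0r.
  rewrite (eq_bigl Q) => [|k] /=; last by case: eqP; case: eqP; rewrite ?andbF.
  by rewrite sumr_const /x; field.
have := orth_generators Be (unitmx1 _ _) orth_weight_basis k1o k1o' k1k1 k2n zk1
  co co' cn cc orth_nilpotent.
by move=> ?; do 5!eexists; eassumption.
Qed.

End OrthogonalGroup.

(** * The special linear group in size at least three *)

Section SpecialLinearGroup.
Variables (K : numFieldType) (m : nat).
Local Notation n := m.+3.
Implicit Types (i j k : 'I_n).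

Lemma SL_form_group d : @SL K d = form_group 0.
Proof.
apply/funext => x; apply/propext; rewrite /SL /form_group/= mulmx0 mul0mx.
by split=> [|[]].
Qed.

Let e i j : 'M[K]_n := delta_mx i j.
Let o : 'I_n := ord0.
Let o1 : 'I_n := lift ord0 ord0.
Let o2 : 'I_n := lift ord0 (lift ord0 ord0).

Lemma form_lie0 (A : 'M[K]_n) : form_lie 0 A <-> \tr A = 0.
Proof.
by rewrite /form_lie/= mulmx0 mul0mx addr0; split=> [[]|].
Qed.

Lemma tr_unit i j : \tr (e i j) = (i == j)%:R.
Proof.
rewrite /mxtrace (bigD1 i)//= big1 ?addr0; last first.
  by move=> k ki; rewrite mxE (negPf ki).
by rewrite mxE eqxx.
Qed.

Lemma unit_mul i j k l : e i j *m e k l = (j == k)%:R *: e i l.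
Proof. by rewrite mul_delta_mx_cond scaler_nat. Qed.

Lemma lie_unit i j : i != j -> form_lie 0 (e i j).
Proof. by move=> ij; apply/form_lie0; rewrite tr_unit (negPf ij). Qed.

Lemma lie_unit_diag i j : form_lie 0 (e i i - e j j).
Proof. by apply/form_lie0; rewrite linearB/= !tr_unit !eqxx subrr. Qed.

Lemma traceless_span (S : set 'M[K]_n) : subspace S ->
  (forall i j, i != j -> S (e i j)) -> (forall i, S (e i i - e o o)) ->
  form_lie 0 `<=` S.
Proof.
move=> Ssub Sij Sii A /form_lie0 A0.
have -> : A = \sum_i (\sum_(j | j != i) A i j *: e i j + A i i *: (e i i - e o o)).
  rewrite {1}(matrix_sum_delta A).
  under [in RHS]eq_bigr do rewrite scalerBr addrA.
  rewrite sumrB -scaler_suml -/(mxtrace A) A0 scale0r subr0.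
  by apply: eq_bigr => i _; rewrite (bigD1 i)//= addrC.
apply: (subspace_sum Ssub) => i _; apply: (subspaceD Ssub).
  apply: (subspace_sum Ssub) => j ji; apply: (subspaceZ Ssub).
  by apply: Sij; rewrite eq_sym.
exact: (subspaceZ Ssub).
Qed.

Lemma traceless_generated (S : set 'M[K]_n) : subspace S ->
  (forall j, j != o -> S (e o j)) -> (forall j, j != o -> S (e j o)) ->
  (forall A C, form_lie 0 A -> S A -> S C -> S (lie_br A C)) ->
  form_lie 0 `<=` S.
Proof.
move=> Ssub S1 S2 Sbr.
have br j k : j != o -> k != o -> S (e j k - (k == j)%:R *: e o o).
  move=> jo ko; have := Sbr _ _ (lie_unit jo) (S2 j jo) (S1 k ko).
  by rewrite /lie_br !unit_mul eqxx scale1r.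
suff [Sij Sii] : (forall i j, i != j -> S (e i j)) /\
    (forall i, S (e i i - e o o)) by exact: (traceless_span Ssub Sij Sii).
split=> [i j ij|i].
  have [io|io] := eqVneq i o; first by rewrite io; apply: S1; rewrite eq_sym -io.
  have [->|jo] := eqVneq j o; first exact: S2.
  by have := br _ _ io jo; rewrite eq_sym (negPf ij) scale0r subr0.
have [->|io] := eqVneq i o; first by rewrite subrr; exact: subspace0.
by have := br _ _ io io; rewrite eqxx scale1r.
Qed.

Lemma unit_vector (j k : 'I_n) i : e i j *m col k 1%:M = (j == k)%:R *: delta_mx i 0.
Proof. by rewrite col1 mul_delta_mx_cond scaler_nat. Qed.

Let mean : K := (\sum_(k < n) (k : nat))%:R / n%:R.
Let l k : K := k%:R - mean.
Let H := conj_diag 1%:M l.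
(** Nonzero entries whose sum over [k != o] is zero, as [m.+1] indices remain besides [o] and [o1].
    This gives [w *m w' = 0], hence [N^3 = 0], and takes at least two indices other than [o]. *)
Let b k : K := if k == o1 then - m.+1%:R else 1.
Let w : 'rV[K]_n := \row_k (k != o)%:R.
Let w' : 'cV[K]_n := \col_k ((k != o)%:R * b k).
Let N : 'M[K]_n := delta_mx o 0 *m w + w' *m delta_mx 0 o.

Lemma SL_lie_br_H i j : lie_br H (e i j) = (l i - l j) *: e i j.
Proof.
rewrite /lie_br /H /conj_diag invmx1 mul1mx mulmx1; apply/matrixP => i' j'.
rewrite [LHS]mxE [X in _ + X]mxE mulmx_diagE mulmx_diagEr !mxE.
by case: eqP => [->|_]; case: eqP => [->|_] /=; ring.
Qed.

Lemma SL_l_inj : injective l.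
Proof.
by move=> i j /addIr /eqP; rewrite eqr_nat => /eqP /val_inj.
Qed.

Lemma SL_H : form_lie 0 H.
Proof.
apply/(form_lie_conj_diag 0 l (unitmx1 _ _)); split; last first.
  by move=> i j; rewrite mulmx0 mul0mx mxE mulr0.
rewrite /l sumrB sumr_const card_ord.
have -> : mean *+ n = (\sum_(k < n) (k : nat))%:R.
  by rewrite -[LHS]mulr_natr /mean divfK// pnatr_eq0.
by rewrite natr_sum subrr.
Qed.

Lemma mul_w_o : w *m delta_mx o 0 = 0 :> 'M[K]_1.
Proof. by rewrite -colE; apply/matrixP => i j; rewrite !mxE eqxx. Qed.

Lemma mul_o_w' : delta_mx 0 o *m w' = 0 :> 'M[K]_1.
Proof. by rewrite -rowE; apply/matrixP => i j; rewrite !mxE eqxx mul0r. Qed.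

Lemma mul_w_w' : w *m w' = 0 :> 'M[K]_1.
Proof.
apply/matrixP => i j; rewrite !mxE (bigD1 o)//= !mxE eqxx mul0r add0r.
rewrite (bigD1 o1)//= !mxE /= /b eqxx mul1r mul1r.
rewrite (eq_bigr (fun=> 1)) => [|k /andP[ko ko1]]; last first.
  by rewrite !mxE ko /b (negPf ko1) !mul1r.
rewrite sumr_const; apply/eqP; rewrite addr_eq0 eqr_opp eqr_nat; apply/eqP.
have := cardC (mem [:: o; o1]); rewrite card_ord (card_uniqP _)//=.
move=> /(congr1 (subn^~ 2)); rewrite addKn !subSS subn0 => mE.
by rewrite -[LHS]mE; apply: eq_card => k; rewrite !inE negb_or orbF.
Qed.

Lemma SL_N3 : N *m N *m N = 0.
Proof.
have d00 : (delta_mx 0 o : 'rV[K]_n) *m (delta_mx o 0 : 'cV[K]_n) = 1%:M.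
  rewrite mul_delta_mx; apply/matrixP => i j; rewrite !mxE !ord1 eqxx.
  by [].
have N2 : N *m N = w' *m w.
  rewrite /N mulmxDl !mulmxDr -!mulmxA (mulmxA w (delta_mx o 0)) mul_w_o.
  rewrite (mulmxA w w') mul_w_w' (mulmxA (delta_mx 0 o) (delta_mx o 0)) d00.
  rewrite (mulmxA (delta_mx 0 o) w') mul_o_w'.
  by rewrite !mul0mx !mulmx0 mul1mx !add0r addr0.
rewrite N2 /N mulmxDr -!mulmxA (mulmxA w (delta_mx o 0)) mul_w_o.
by rewrite (mulmxA w w') mul_w_w' !mul0mx !mulmx0 addr0.
Qed.

(** The components of [N] in the first row and the first column; zeros at index [o] let the sum
    range over a full finite type. *)
Let v (bk : bool * 'I_n) : 'M[K]_n :=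
  if bk.2 == o then 0 else if bk.1 then e o bk.2 else b bk.2 *: e bk.2 o.

Lemma SL_N_sum : N = \sum_bk v bk.
Proof.
have wE : w = \sum_(k | k != o) delta_mx 0 k.
  apply/rowP => i; rewrite summxE mxE; case: (eqVneq i o) => io /=.
    by rewrite big1// => k ko; rewrite mxE io eq_sym (negPf ko).
  rewrite (bigD1 i)//= mxE !eqxx big1 ?addr0// => k /andP[_ ki].
  by rewrite mxE eq_sym (negPf ki).
have wE' : w' = \sum_(k | k != o) b k *: delta_mx k 0.
  apply/colP => i; rewrite summxE mxE; case: (eqVneq i o) => io /=.
    by rewrite mul0r big1// => k ko; rewrite !mxE io eq_sym (negPf ko) mulr0.
  rewrite (bigD1 i)//= !mxE !eqxx big1 ?addr0 ?mulr1 ?mul1r// => k /andP[_ ki].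
  by rewrite !mxE eq_sym (negPf ki) mulr0.
rewrite -(pair_bigA _ (fun c k => v (c, k)))/= big_bool/= /N wE wE'.
rewrite mulmx_sumr mulmx_suml /v /=; congr (_ + _).
  rewrite [RHS](bigID (fun k => k != o))/= [X in _ = _ + X]big1 ?addr0.
    by apply: eq_bigr => k /negPf ->; rewrite mul_delta_mx.
  by move=> k; rewrite negbK => ->.
rewrite [RHS](bigID (fun k => k != o))/= [X in _ = _ + X]big1 ?addr0.
  by apply: eq_bigr => k /negPf ->; rewrite -scalemxAl mul_delta_mx.
by move=> k; rewrite negbK => ->.
Qed.

(** The shift by [mean] cancels in differences, so the components have the integer weights [-k] and
    [k] with [k > 0], all distinct. The matrix units of the first row and column then generate. *)
Lemma SL_Lie (S : set 'M[K]_n) : subspace S ->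
  (forall A C, S A -> S C -> S (lie_br A C)) ->
  (forall A, S A -> S (lie_br H A)) -> S N -> form_lie 0 `<=` S.
Proof.
move=> Ssub Sbr SH; rewrite SL_N_sum => Sv.
pose lam (bk : bool * 'I_n) : K :=
  if bk.1 then l o - l bk.2 else l bk.2 - l o.
have Hv bk : lie_br H (v bk) = lam bk *: v bk.
  rewrite /v /lam; case: eqP => _.
    by rewrite /lie_br mulmx0 mul0mx subrr scaler0.
  case: bk.1; first exact: SL_lie_br_H.
  rewrite /lie_br -scalemxAl -scalemxAr -scalerBr -/(lie_br _ _) SL_lie_br_H.
  by rewrite !scalerA mulrC.
have key c k : k != o -> S (v (c, k)).
  move=> ko; have := subspace_eigen Ssub SH (lie_br_linear Hv) Sv (c, k).
  have ll i j : l i - l j = (i%:Z - j%:Z)%:~R.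
    by rewrite /l rmorphB/= opprB addrA subrK.
  rewrite (bigD1 (c, k))//= big1 ?addr0// => -[c' k'] /andP[/eqP lamE ne].
  rewrite /v /=; case: eqVneq => // k'o; exfalso.
  move: lamE ne ko k'o; rewrite /lam xpair_eqE -!(inj_eq val_inj)/=.
  by case: c; case: c' => /=; rewrite ?eqxx !ll => /intr_inj /=; lia.
have S1 k : k != o -> S (e o k).
  by move=> ko; have := key true _ ko; rewrite /v /= (negPf ko).
have S2 k : k != o -> S (e k o).
  move=> ko; have := key false _ ko; rewrite /v /= (negPf ko).
  apply: subspaceZK => //; rewrite /b; case: (k == o1); last exact: oner_neq0.
  by rewrite oppr_eq0 pnatr_eq0.
exact: (traceless_generated Ssub S1 S2 (fun A C _ => @Sbr A C)).
Qed.

Lemma SL_ideal (S : set 'M[K]_n) : subspace S ->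
  (forall A C, form_lie 0 A -> S C -> S (lie_br A C)) -> S (e o o1) ->
  form_lie 0 `<=` S.
Proof.
move=> Ssub Sbr SE.
have movel i j k : k != i -> k != j -> S (e i j) -> S (e k j).
  move=> ki kj Sij; have := Sbr _ _ (lie_unit ki) Sij.
  by rewrite /lie_br !unit_mul eqxx scale1r eq_sym (negPf kj) scale0r subr0.
have mover i j k : k != j -> k != i -> S (e i j) -> S (e i k).
  move=> kj ki Sij.
  have jk : j != k by rewrite eq_sym.
  have := Sbr _ _ (lie_unit jk) Sij.
  rewrite /lie_br !unit_mul eqxx scale1r (negPf ki) scale0r sub0r.
  by move=> /(subspaceN Ssub); rewrite opprK.
have S1 j : j != o -> S (e o j).
  by move=> jo; have [->//|jo1] := eqVneq j o1; apply: (mover _ _ _ jo1 jo SE).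
have S2 j : j != o -> S (e j o).
  move=> jo; have [j1|j1] := eqVneq j o1; last first.
    by apply: (mover _ o1) => //; [rewrite eq_sym|apply: (movel o)].
  (* The transposed position is reached through the third index [o2], as both moves require the new
     index to differ from the old row and column. *)
  have S20 : S (e o2 o) by apply: (mover _ o1) => //; apply: (movel o).
  by rewrite j1; apply: (movel o2).
exact: (traceless_generated Ssub S1 S2 (fun A C gA _ => Sbr A C gA)).
Qed.

Lemma SL_vectors (S : set 'cV[K]_n) : subspace S ->
  (forall A k, form_lie 0 A -> e o o1 *m col k 1%:M = 0 ->
    l k + (l o - l o1) != 0 -> S (A *m col k 1%:M)) -> forall u, S u.
Proof.
move=> Ssub SA u.
have Eo : e o o1 *m col o 1%:M = 0 by rewrite unit_vector scale0r.
have lo : l o + (l o - l o1) != 0.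
  have l0 : l o = - mean by rewrite /l sub0r.
  have l1 : l o1 = 1 - mean by [].
  have -> : l o + (l o - l o1) = - (mean + 1) by rewrite l0 l1; ring.
  rewrite oppr_eq0 gt_eqF// ltr_wpDl// divr_ge0//.
suff Sd i : S (delta_mx i 0).
  rewrite (matrix_sum_delta u); apply: (subspace_sum Ssub) => i _.
  by rewrite big_ord1; exact: (subspaceZ Ssub).
have [->|io] := eqVneq i o.
  have := SA _ _ (lie_unit_diag o o1) Eo lo.
  by rewrite mulmxBl !unit_vector eqxx scale1r scale0r subr0.
by have := SA _ _ (lie_unit io) Eo lo; rewrite unit_vector eqxx scale1r.
Qed.

Lemma SL_nilpotent (S : set 'M[K]_n) : subspace S ->
  (forall A, form_lie 0 A -> A *m A *m A = 0 -> S A) -> form_lie 0 `<=` S.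
Proof.
move=> Ssub SA.
have Sij i j : i != j -> S (e i j).
  move=> ij; apply: SA; first exact: lie_unit.
  by rewrite unit_mul eq_sym (negPf ij) scale0r mul0mx.
apply: (traceless_span Ssub Sij) => i.
have [->|io] := eqVneq i o; first by rewrite subrr; exact: subspace0.
have oi : o != i by rewrite eq_sym.
(* This is the rank-one matrix [(e_i + e_o) (e_i - e_o)^T]; its two factors are orthogonal, so it
   squares to zero. *)
pose A := e i i - e o o + (e o i - e i o).
have SA' : S A.
  apply: SA.
    apply: (subspaceD (form_lie_subspace 0)); first exact: lie_unit_diag.
    by apply: (subspaceB (form_lie_subspace 0)); exact: lie_unit.
  have -> : A *m A = 0; last by rewrite mul0mx.
  rewrite /A !(mulmxDl, mulmxDr, mulmxBl, mulmxBr, mulmxN, mulNmx) !unit_mul.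
  rewrite !eqxx (negPf io) (negPf oi) !scale0r !scale1r.
  by apply/matrixP => i' j'; rewrite !mxE; ring.
have := subspaceB Ssub SA' (subspaceB Ssub (Sij _ _ oi) (Sij _ _ io)).
by rewrite /A addrK.
Qed.

Lemma SL_projector : exists pr : 'I_n -> 'I_n -> 'M[K]_n,
  (forall i j, form_lie 0 (pr i j)) /\
  (forall A, form_lie 0 A -> A = \sum_i \sum_j A i j *: pr i j).
Proof.
exists (fun i j => e i j - (i == j)%:R *: e o o); split=> [i j|A].
  by apply/form_lie0; rewrite linearB linearZ/= !tr_unit eqxx mulr1 subrr.
move=> /form_lie0 A0; rewrite {1}(matrix_sum_delta A).
under [in RHS]eq_bigr do under eq_bigr do rewrite scalerBr.
under [in RHS]eq_bigr do rewrite sumrB.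
rewrite sumrB [X in _ - X](_ : _ = \tr A *: e o o).
  by rewrite A0 scale0r subr0.
rewrite scaler_suml; apply: eq_bigr => i _; rewrite (bigD1 i)//= eqxx scale1r.
rewrite big1 ?addr0// => j ji.
by rewrite eq_sym (negPf ji) scale0r scaler0.
Qed.

Lemma SL_generators : exists P l N E a, generators (0 : 'M[K]_n) P l N E a.
Proof.
exists 1%:M, l, N, (e o o1), (l o - l o1); split.
- exact: unitmx1.
- exact: SL_l_inj.
- exact: SL_H.
- apply/form_lie0; rewrite /N linearD/= !(mxtrace_mulC (delta_mx o 0)).
  by rewrite mul_w_o mxtrace_mulC mul_o_w' !mxtrace0 addr0.
- exact: SL_N3.
- exact: lie_unit.
- by rewrite unit_mul scale0r.
- exact: SL_lie_br_H.
- exact: SL_Lie.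
- exact: SL_ideal.
- exact: SL_vectors.
- exact: SL_nilpotent.
- exact: SL_projector.
Qed.

End SpecialLinearGroup.

(** In size two [x^T Omega x = (det x) Omega]. *)
Lemma SL2_form_group (K : numFieldType) : @SL K 2 = form_group (Omega K 1).
Proof.
apply/funext => x; apply/propext; split=> [x1|[]//]; split=> //.
have OE : Omega K 1 = \matrix_(i, j) ((i < j)%:R - (j < i)%:R).
  apply/matrixP => i j; rewrite /Omega.
  case: (split_ordP i) => i' ->; case: (split_ordP j) => j' ->;
    rewrite ?(block_mxEul, block_mxEur, block_mxEdl, block_mxEdr) !mxE !ord1/=.
  - by rewrite subrr.
  - by rewrite subr0.
  - by rewrite sub0r.
  - by rewrite subrr.
have {}x1 : x 0 0 * x 1 1 - x 0 1 * x 1 0 = 1.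
  have lift00 : lift 0 0 = 1 :> 'I_2 by exact: val_inj.
  have lift10 : lift 1 0 = 0 :> 'I_2 by exact: val_inj.
  rewrite -x1 (expand_det_row _ 0) !big_ord_recl big_ord0 /cofactor !det_mx11 !mxE.
  rewrite !lift00 lift10 /= expr0 expr1.
  by ring.
apply/matrixP => i j; rewrite OE !mxE !big_ord_recl !big_ord0 !mxE.
rewrite !big_ord_recl !big_ord0 !mxE /=.
have -> : lift ord0 ord0 = 1 :> 'I_2 by exact: val_inj.
have ord2 (k : 'I_2) : k = 0 \/ k = 1.
  by case: k => [[|[|//]] ?]; [left|right]; exact: val_inj.
have -> : ord0 = 0 :> 'I_2 by [].
have [->|->] := ord2 i; have [->|->] := ord2 j => /=.
- by ring.
- by transitivity (x 0 0 * x 1 1 - x 0 1 * x 1 0); [ring|rewrite x1; ring].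
- by transitivity (- (x 0 0 * x 1 1 - x 0 1 * x 1 0)); [ring|rewrite x1; ring].
- by ring.
Qed.

Theorem theorem1p1 (R : realType) (d : nat) (G : set 'M[R[i]]_d) :
  classical_group G ->
  exists W1 W2 W3 : matrix_field G,
    [/\ X_alg G W1 /\ C_complete W1,
        X_alg G W2 /\ C_complete W2,
        X_alg G W3 /\ C_complete W3
      & X_alg G = lie_generated [set W1; W2; W3]].
Proof.
have ex := cexp_is_exponential R.
case=> n.
- case: n => [|[|[|n]]]// _.
    rewrite SL2_form_group.
    have [P [l [N [E [a gens]]]]] :=
      Sp_generators (R[i] : numFieldType) (isT : (0 < 1)%N).
    exact: (form_group_generators ex gens).
  rewrite SL_form_group.
  have [P [l [N [E [a gens]]]]] := SL_generators (R[i] : numFieldType) n.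
  exact: (form_group_generators ex gens).
- move=> n5; rewrite SO_form_group.
  have im2 : 'i * 'i = -1 :> R[i] by rewrite -expr2 sqr_i.
  have [P [l [N [E [a gens]]]]] := @SO_generators (R[i] : numFieldType) n 'i im2 n5.
  exact: (form_group_generators ex gens).
- move=> n0; rewrite Sp_form_group.
  have [P [l [N [E [a gens]]]]] := Sp_generators (R[i] : numFieldType) n0.
  exact: (form_group_generators ex gens).
Qed.
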